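(* For every integer $d\ge 2$ and every $r\in\mathbb{C}$, the vertex operator algebra $V_{\mathcal{J}}$ (of central charge $dr$) is simple if and only if $r\notin\mathbb{Z}$.
   Context: Fix an integer $d\ge 2$ and $r\in\mathbb{C}$. Let $\hat{\mathfrak h}$ be the complex Lie algebra with basis $\{v^i(m)\mid 1\le i\le d,\ m\in\mathbb{Z}\}\cup\{\mathbf c\}$ and bracket $[v^i(m),v^j(n)]=\delta_{m+n,0}\delta_{i,j}\,m\,\mathbf c$, $[\mathbf c,\hat{\mathfrak h}]=0$. In $A=U(\hat{\mathfrak h})/\langle \mathbf c-1\rangle$ let $v^{ij}(m,n)$ be the image of $v^i(m)v^j(n)$; then $v^{ij}(m,n)=v^{ji}(n,m)$ unless $i=j$ and $m=-n$, and $v^{ii}(m,-m)=v^{ii}(-m,m)+m$. Let $\mathcal B=\{v^{ii}(m,n)\mid 1\le i\le d,\ m\le n\}\cup\{v^{ij}(m,n)\mid 1\le i<j\le d,\ m,n\in\mathbb Z\}$; then $\mathcal B\cup\{1\}$ is linearly independent, $\mathcal L:=\mathrm{span}_{\mathbb C}\mathcal B\oplus\mathbb C\subset A$ contains every $v^{ij}(m,n)$ and is closed under $[x,y]=xy-yx$. With $\pi_1,\pi_2$ the projections of $\mathcal L$ onto $\mathrm{span}\,\mathcal B$ and onto $\mathbb C$, the formula $[x,y]_r=\pi_1([x,y])+r\pi_2([x,y])$ defines a Lie bracket on $\mathcal L$; call this Lie algebra $\mathcal L_r$. Let $\mathcal B_+=\{v^{ij}(m,n)\in\mathcal B\mid m\ge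 0\text{ or }n\ge 0\}$, $\mathcal B_-=\{v^{ij}(m,n)\in\mathcal B\mid m,n<0\}$, $\mathcal L_r^+=\mathrm{span}\,\mathcal B_+\oplus\mathbb C$ (a subalgebra), and $M_r=U(\mathcal L_r)\otimes_{U(\mathcal L_r^+)}\mathbb C\mathbf 1$, where $\mathcal B_+$ acts by $0$ on $\mathbf 1$ and $s\in\mathbb C\subset \mathcal L_r$ acts by the scalar $s$. Elements of $\mathcal B_-$ commute, monomials in $\mathcal B_-$ applied to $\mathbf 1$ form a basis of $M_r$, and $M_r=\bigoplus_{n\ge0}(M_r)_n$ is graded by giving $x_p\cdots x_1\mathbf 1$ with $x_q=v^{i_qj_q}(m_q,n_q)\in\mathcal B_-$ degree $-\sum_q(m_q+n_q)$. Define operators on $M_r$: $L_r^{ij}(m)=\frac12\sum_{h\in\mathbb Z}v^{ij}(m-h,h)$ if $i\ne j$ or $m\ne0$, and $L_r^{ii}(0)=\frac12 v^{ii}(0,0)+\sum_{h>0}v^{ii}(-h,h)$. Let $\omega_r^{ij}=L_r^{ij}(-2)\mathbf 1$, $\omega=\sum_i\omega_r^{ii}$, and let $V_{\mathcal J}\subset M_r$ be the span of all $L_r^{i_1j_1}(m_1)\cdots L_r^{i_pj_p}(m_p)\mathbf 1$ ($p\ge0$), graded by $(V_{\mathcal J})_n=V_{\mathcal J}\cap (M_r)_n$. By a theorem of Ashihara–Miyamoto, there is a unique linear map $Y(\cdot,z):V_{\mathcal J}\to\mathrm{End}(V_{\mathcal J})[[z,z^{-1}]]$ with $Y(\omega_r^{ij},z)=\sum_m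 L_r^{ij}(m)z^{-m-2}$ and $Y(\mathbf 1,z)=\mathrm{Id}$ making $(V_{\mathcal J},Y,\mathbf 1,\omega)$ a vertex operator algebra of central charge $dr$ (its Griess algebra is isomorphic to the Jordan algebra of $d\times d$ symmetric matrices). Simple means having no ideals other than $0$ and itself. *)

(* Defs.v *)
From HB Require Import structures.
From mathcomp Require Import all_boot all_order all_algebra.
From mathcomp Require Import complex.
From mathcomp Require Import reals Rstruct.
From mathcomp.finmap Require Import finmap multiset.
From mathcomp.multinomials Require Import monalg.

Set Implicit Arguments.
Unset Strict Implicit.
Unset Printing Implicit Defensive.

Import Order.TTheory GRing.Theory Num.Theory.
Local Open Scope ring_scope.

Definition C : fieldType := (Rdefinitions.R)[i].

Section VJ.
Variable d : nat.   (* number of Heisenberg generators v^1..v^d (indices 'I_d) *)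
Variable r : C.

(* key (i, j, m, n) stands for v^{ij}(m,n) = image of v^i(m) v^j(n) in A *)
Definition key := ('I_d * 'I_d * int * int)%type.

Definition inB (k : key) : bool :=
  let: (i, j, m, n) := k in (i < j)%N || ((i == j) && (m <= n)).
Definition inBminus (k : key) : bool :=
  let: (i, j, m, n) := k in inB k && (m < 0) && (n < 0).

(* Writing v^{ij}(m,n) in the basis B \cup {1} of L: (basis element, constant). *)
Definition nrm (k : key) : key * C :=
  let: (i, j, m, n) := k in
  if (i < j)%N then ((i, j, m, n), 0)
  else if (j < i)%N then ((j, i, n, m), 0)
  else if m <= n then ((i, j, m, n), 0)
  else ((i, j, n, m), if m + n == 0 then m%:~R else 0).
(* (for i = j, m > n = -m:  v^{ii}(m,-m) = v^{ii}(-m,m) + m) *)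

(* [v^i(m) v^j(n), v^k(p) v^l(q)] in A, as a list of (coefficient, v^{..}(..)):
   = [v^j(n),v^k(p)] v^{il}(m,q) + [v^j(n),v^l(q)] v^{ik}(m,p)
   + [v^i(m),v^k(p)] v^{lj}(q,n) + [v^i(m),v^l(q)] v^{kj}(p,n),
   with [v^a(x), v^b(y)] = delta_{ab} delta_{x+y,0} x. *)
Definition hbr (a b : 'I_d) (x y : int) : C :=
  if (a == b) && (x + y == 0) then x%:~R else 0.

Definition brA (b c : key) : seq (C * key) :=
  let: (i, j, m, n) := b in let: (k, l, p, q) := c in
  [:: (hbr j k n p, (i, l, m, q)); (hbr j l n q, (i, k, m, p));
      (hbr i k m p, (l, j, q, n)); (hbr i l m q, (k, j, p, n))].

(* The bracket [b, c]_r = pi_1([b,c]) + r pi_2([b,c]):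
   the span-B part as a list of (coefficient, basis element) ... *)
Definition brB (b c : key) : seq (C * key) :=
  [seq (t.1, (nrm t.2).1) | t <- brA b c].
Definition brC (b c : key) : C :=
  r * \sum_(t <- brA b c) t.1 * (nrm t.2).2.

(* M_r: monomials in B_- applied to 1 are a basis; a monomial is a multiset
   of elements of B_-, and M_r is the space of finitely supported
   C-linear combinations of monomials. *)
Definition Mon := {mset key}%mset.
Definition Vec := {malg C[Mon]}.

Definition mset_of_seq (w : seq key) : Mon := foldr (fun k m => (k +` m)%mset) mset0 w.
Definition monv (w : seq key) : Vec := << mset_of_seq w >>.
Definition vac : Vec := << mset0 >>.

(* multiplication by an element c of B_- (elements of B_- commute) *)
Definition mulB (c : key) (v : Vec) : Vec :=
  \sum_(m <- msupp v) v@_m *: << (c +` m)%mset >>.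

(* action of a basis element b of B on the monomial w . 1 (w a word in B_-):
   b in B_- multiplies; b in B_+ kills 1 and b c P = c (b P) + [b,c]_r P. *)
Fixpoint actw (b : key) (w : seq key) {struct w} : Vec :=
  if inBminus b then monv (b :: w) else
  match w with
  | [::] => 0
  | c :: w' =>
      mulB c (actw b w')
      + \sum_(t <- brB b c)
          t.1 *: (if inBminus t.2 then monv (t.2 :: w') else actw t.2 w')
      + brC b c *: monv w'
  end.

Definition actRaw (k : key) (w : seq key) : Vec :=
  actw (nrm k).1 w + (nrm k).2 *: monv w.

(* A bound beyond which all terms of the (formally infinite) sums defining
   L^{ij}(m) vanish on w . 1. *)
Definition bnd (m : int) (w : seq key) : nat :=
  (`|m| + \sum_(k <- w) (`|k.1.2| + `|k.2|) + 1)%N.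

Definition LopW (i j : 'I_d) (m : int) (w : seq key) : Vec :=
  let K := bnd m w in
  if (i == j) && (m == 0) then
    2^-1 *: actRaw (i, i, 0, 0) w
    + \sum_(1 <= h < K.+1) actRaw (i, i, - (h%:Z), h%:Z) w
  else
    2^-1 *: \sum_(0 <= t < (K + K).+1)
               actRaw (i, j, m - (t%:Z - K%:Z), t%:Z - K%:Z) w.

Definition Lop (i j : 'I_d) (m : int) (v : Vec) : Vec :=
  \sum_(mm <- msupp v) v@_mm *: LopW i j m (enum_mset mm).

Definition Lmon (s : seq ('I_d * 'I_d * int)) : Vec :=
  foldr (fun t v => Lop t.1.1 t.1.2 t.2 v) vac s.

Definition inVJ (v : Vec) : Prop :=
  exists s : seq (C * seq ('I_d * 'I_d * int)),
    v = \sum_(x <- s) x.1 *: Lmon x.2.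

Definition omega_ij (i j : 'I_d) : Vec := Lop i j (-2) vac.
(* Virasoro operators L(m) = sum_i L^{ii}(m)  (Y(omega,z) = sum_m L(m) z^{-m-2}) *)
Definition Lvir (m : int) (v : Vec) : Vec := \sum_(i < d) Lop i i m v.

Definition binz (p : int) (k : nat) : C :=
  (\prod_(l < k) (p%:~R - l%:R)) / (k`!)%:R.

(* A vertex operator map Y(u,z) = sum_n u_n z^{-n-1} on V_J is encoded by its
   modes:  Y u n w = u_n w. *)
Definition IsVOA (Y : Vec -> int -> Vec -> Vec) : Prop :=
  (forall u w n, inVJ u -> inVJ w -> inVJ (Y u n w)) /\
  (forall (a : C) u u' w n, inVJ u -> inVJ u' -> inVJ w ->
      Y (a *: u + u') n w = a *: Y u n w + Y u' n w) /\
  (forall (a : C) u w w' n, inVJ u -> inVJ w -> inVJ w' ->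
      Y u n (a *: w + w') = a *: Y u n w + Y u n w') /\
  (forall u w, inVJ u -> inVJ w -> exists N : int, forall n, N <= n -> Y u n w = 0) /\
  (forall w n, inVJ w -> Y vac n w = if n == -1 then w else 0) /\
  (forall u, inVJ u -> Y u (-1) vac = u /\ forall n, 0 <= n -> Y u n vac = 0) /\
  (* Jacobi identity, in the equivalent Borcherds (mode) form; all sums are
     finite by truncation, K being any common truncation bound *)
  (forall u v w (p q n : int) (K : nat), inVJ u -> inVJ v -> inVJ w ->
     (forall i : nat, (K <= i)%N ->
        [/\ Y u (n + i%:Z) v = 0, Y v (q + i%:Z) w = 0 & Y u (p + i%:Z) w = 0]) ->
     \sum_(i < K) binz p i *: Y (Y u (n + i%:Z) v) (p + q - i%:Z) w
     = \sum_(i < K) ((-1) ^+ i * binz n i) *: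
         (Y u (p + n - i%:Z) (Y v (q + i%:Z) w)
          - ((-1 : C) ^ n) *: Y v (q + n - i%:Z) (Y u (p + i%:Z) w))) /\
  (* L(-1)-derivative property: Y(L(-1)v, z) = d/dz Y(v, z) *)
  (forall v w n, inVJ v -> inVJ w ->
     Y (Lvir (-1) v) n w = - (n%:~R) *: Y v (n - 1) w) /\
  (* Y(omega^{ij}, z) = sum_m L^{ij}(m) z^{-m-2}, i.e. (omega^{ij})_n = L^{ij}(n-1) *)
  (forall (i j : 'I_d) w n, inVJ w -> Y (omega_ij i j) n w = Lop i j (n - 1) w).

Definition IsIdeal (Y : Vec -> int -> Vec -> Vec) (I : Vec -> Prop) : Prop :=
  (forall v, I v -> inVJ v) /\ I 0 /\
  (forall (a : C) v w, I v -> I w -> I (a *: v + w)) /\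
  (forall u w n, inVJ u -> I w -> I (Y u n w) /\ I (Y w n u)).

Definition IsSimple (Y : Vec -> int -> Vec -> Vec) : Prop :=
  forall I, IsIdeal Y I ->
    (forall v, I v <-> v = 0) \/ (forall v, I v <-> inVJ v).

End VJ.

(* Main.v *)
(* The ideals of V_J are its subspaces closed under all L^{ij}(m), by the
   associativity and commutator formulas. Weights for L^{jj}(0) separate the
   summands v^{ij}(m,n), i <> j, of L^{ij}(m), and commutators then give those
   with i = j; so such a subspace is closed under multiplication by the
   quadratic elements x_ab (a, b creation labels) and under the second order
   operators D_ab coming from v^{ij}(m,n), m, n > 0. In particular V_J = M_r.
   If v is killed by all D_ab, its Taylor coefficients, as functions of words of
   labels, are eigenvectors of eigenvalue -r of a Jucys-Murphy element. Its
   eigenvalues are integers, so v is constant when r is not an integer, and every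
   nonzero ideal contains the vacuum. If r is an integer, the radical of the
   contravariant form is a proper ideal; it contains the vectors x_aa^s for
   r = 2 - 2s, (x_aa x_bb - x_ab^2)^s for r = 3 - 2s, and the determinants
   det (x_{c_p e_q}) of size r + 1 for r >= 0, all killed by the D_ab. *)
Require Import Defs.
From HB Require Import structures.
From mathcomp Require Import all_boot all_order all_algebra all_fingroup.
From mathcomp Require Import complex.
From mathcomp Require Import reals Rstruct.
From mathcomp.finmap Require Import finmap multiset.
From mathcomp.multinomials Require Import monalg.
From mathcomp Require Import zify ring.
From Stdlib Require Import FunctionalExtensionality Classical_Prop.

Set Implicit Arguments.
Unset Strict Implicit.
Unset Printing Implicit Defensive.

Import Order.TTheory GRing.Theory Num.Theory.
Local Open Scope ring_scope.

(** For a natural number r the formulas come from commuting variables y_at, 1 <= t <= r: x_ab is the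
    sum over t of y_at y_bt, D_ab the sum of the products of the derivatives by y_at and y_bt, and
    the replacement of a by b the sum of y_bt times the derivative by y_at. The scalar products of
    two families of r + 1 vectors in dimension r have determinant 0, which suggests the minors.
    Anticommuting variables count negatively: n pairs of them give r = -2n and x_aa^(n+1) = 0; one
    more commuting variable gives r = 1 - 2n. That the suggested vectors are singular is proved
    inside M_r, by moving D_ab through them. Transpositions enter because the part of D_ab free of r
    has linear coefficients: its commutator with a partial derivative is a sum of products of two
    derivatives, in which b has traded places with an earlier label. The concrete space has
    monomials in all keys and reads a monomial in an arbitrary order; so operators need a check of
    permutation invariance, and the formulas for L^{ij}(m) are proved on the span of the monomials
    in B_- only. *)

Lemma natC_neq0 (n : nat) : (n.+1%:R : C) != 0.
Proof.
have h : (n.+1%:R : (Rdefinitions.R)[i]%C) != 0 by rewrite pnatr_eq0.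
exact: h.
Qed.

Lemma intC_inj (m n : int) : (m%:~R : C) = n%:~R -> m = n.
Proof. exact: (@intr_inj (Rdefinitions.R)[i]%C). Qed.

(** * Linear extension of functions of words *)

Section LinearExtension.
Variable d : nat.
Local Notation V := (Vec d).
Local Notation Mon := (Mon d).
Local Notation key := (key d).

Definition linM (f : Mon -> V) (v : V) : V :=
  \sum_(m <- msupp v) v@_m *: f m.

Lemma linMEw (f : Mon -> V) (v : V) (D : {fset Mon}) :
  (msupp v `<=` D)%fset -> linM f v = \sum_(m <- D) v@_m *: f m.
Proof.
move=> le_vD; rewrite /linM (big_fset_incl _ le_vD) // => m _ m_v.
by rewrite mcoeff_outdom // scale0r.
Qed.

Lemma linM_is_linear f : linear (linM f).
Proof.
move=> a u v; pose D := (msupp u `|` msupp v `|` msupp (a *: u + v))%fset.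
have leu : (msupp u `<=` D)%fset by rewrite /D -fsetUA fsubsetUl.
have lev : (msupp v `<=` D)%fset
  by apply: fsubset_trans (fsubsetUl _ _); rewrite fsubsetUr.
rewrite !(@linMEw _ _ D) ?fsubsetUr // scaler_sumr -big_split /=.
by apply: eq_bigr => m _; rewrite mcoeffD mcoeffZ scalerDl scalerA.
Qed.
HB.instance Definition _ f :=
  GRing.isLinear.Build C V V *:%R (linM f) (linM_is_linear f).

Lemma linMU f m : linM f << m >> = f m.
Proof.
rewrite (@linMEw _ _ [fset m]%fset) ?msuppU_le // big_seq_fset1.
by rewrite mcoeffUU scale1r.
Qed.

HB.instance Definition _ (c : key) :=
  GRing.isLinear.Build C V V *:%R (mulB c)
    (linM_is_linear (fun m => << (c +` m)%mset >>)).

(** A monomial is read off its arbitrary enumeration, just as in [Lop], so that [LopE] holds by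
    conversion; [lin f (monv w)] need not be [f w] unless [f] is permutation invariant. *)
Definition lin (f : seq key -> V) : V -> V := linM (fun m => f (enum_mset m)).
HB.instance Definition _ f := GRing.Linear.on (lin f).

Lemma mulB_monv (c : key) w : mulB c (monv w) = monv (c :: w).
Proof. exact: (linMU (fun m => << (c +` m)%mset >>)). Qed.

Lemma mset_of_seqE (w : seq key) k : mset_of_seq w k = count_mem k w.
Proof. by elim: w => [|c w IH] /=; rewrite ?mset0E // mset1DE IH eq_sym. Qed.

Lemma perm_mset_of_seq (w : seq key) : perm_eq (enum_mset (mset_of_seq w)) w.
Proof. by apply/allP => k _ /=; rewrite count_mem_mset mset_of_seqE. Qed.

Lemma enum_msetK (m : Mon) : mset_of_seq (enum_mset m) = m.
Proof. by apply/msetP => k; rewrite mset_of_seqE count_mem_mset. Qed.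

Lemma mset_of_seq_perm (w w' : seq key) :
  perm_eq w w' -> mset_of_seq w = mset_of_seq w'.
Proof. by move=> /seq.permP h; apply/msetP => k; rewrite !mset_of_seqE h. Qed.

Lemma monv_perm (w w' : seq key) : perm_eq w w' -> monv w = monv w'.
Proof. by move=> h; rewrite /monv (mset_of_seq_perm h). Qed.

Lemma monvE (m : Mon) : << m >> = monv (enum_mset m) :> V.
Proof. by rewrite /monv enum_msetK. Qed.

Lemma lin_monv (f : seq key -> V) w :
  lin f (monv w) = f (enum_mset (mset_of_seq w)).
Proof. exact: (linMU (fun m => f (enum_mset m))). Qed.

Lemma mulB_coef c (v : V) m :
  (mulB c v)@_m = if c \in (m : {mset key}%mset) then v@_(m `\ c)%mset else 0.
Proof.
rewrite /mulB raddf_sum /=.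
transitivity (\sum_(m' <- msupp v) v@_m' *+ ((c +` m')%mset == m)).
  by apply: eq_bigr => m' _; rewrite mcoeffZ mcoeffU mulrnAr mulr1.
case: ifP => [cm|/negP cm]; last first.
  rewrite big1 // => m' _; case: eqP => // e.
  by case: cm; rewrite -e mset1D1.
have eqm m' : ((c +` m')%mset == m) = (m' == (m `\ c)%mset).
  by apply/eqP/eqP => [<-|->]; rewrite ?msetD1K ?msetB1K.
under eq_bigr do rewrite eqm.
case: (boolP ((m `\ c)%mset \in msupp v)) => [h|h].
  rewrite (bigD1_seq _ h) ?fset_uniq //= eqxx big1 ?addr0 ?mulr1n //.
  by move=> m' /negPf ->.
rewrite (mcoeff_outdom h) big1_seq // => m' /andP [_ m'v].
by case: eqP => // e; rewrite -e m'v in h.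
Qed.

(** Transpositions at the head of a word suffice: a recursively defined operator is well defined on
    monomials once its recursion steps for the first two letters commute. *)
Lemma perm_invariant T (f : seq key -> T) :
  (forall c w w', f w = f w' -> perm_eq w w' -> f (c :: w) = f (c :: w')) ->
  (forall b c w, f (b :: c :: w) = f (c :: b :: w)) ->
  forall w w', perm_eq w w' -> f w = f w'.
Proof.
move=> fcons fswap.
have fcat c s1 s2 : f (c :: s1 ++ s2) = f (s1 ++ c :: s2).
  elim: s1 => //= b s1 IH; rewrite fswap; apply: fcons => //.
  by rewrite -cat1s perm_catCA.
move=> w; elim: w => [|c w IH] w' ww'.
  by move: ww'; rewrite perm_sym => /perm_nilP ->.
have cw' : c \in w' by rewrite -(perm_mem ww') mem_head.
case/splitPr: cw' ww' => s1 s2; rewrite -fcat -[c :: s2]cat1s perm_sym perm_catCA.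
rewrite perm_cons perm_sym => ww'.
by apply: fcons => //; apply: IH.
Qed.

Lemma malgUZ (a : C) (m : Mon) : << a *g m >> = a *: << m >> :> V.
Proof. by apply/malgP => k; rewrite mcoeffZ [in LHS]mcoeffU mcoeffU mulrnAr mulr1. Qed.

Lemma Vec_ind_supp (S : {pred key}) (P : V -> Prop) :
  P 0 -> (forall (a : C) u v, P u -> P v -> P (a *: u + v)) ->
  (forall w, all S w -> P (monv w)) ->
  forall v, (forall m, m \in msupp v -> all S (enum_mset m)) -> P v.
Proof.
move=> P0 PD Pm v vS; rewrite [v]monalgE.
have {vS} : forall m, m \in (msupp v : seq _) -> all S (enum_mset m) by [].
elim: (msupp v : seq _) => [|m s IH] h; first by rewrite big_nil.
rewrite big_cons malgUZ; apply: PD;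
  last by apply: IH => k ks; apply: h; rewrite inE ks orbT.
by rewrite monvE; apply: Pm; apply: h; rewrite mem_head.
Qed.

End LinearExtension.

(* What is used of the space M_r = C[B_-]. Arguing about an arbitrary [Fock]
   keeps unification from unfolding the concrete model. *)
Record Fock (d : nat) := MkFock {
  FV :> lmodType C;
  mul : key d -> {linear FV -> FV};
  mv : seq (key d) -> FV;
  ext : (seq (key d) -> FV) -> {linear FV -> FV};
  coef : Mon d -> {scalar FV};
  mul_mv : forall c w, mul c (mv w) = mv (c :: w);
  mv_perm : forall w w', perm_eq w w' -> mv w = mv w';
  ext_enum : forall f w, ext f (mv w) = f (enum_mset (mset_of_seq w));
  coef_inj : forall u v, (forall m, coef m u = coef m v) -> u = v;
  coef_mul : forall c v (m : {mset key d}%mset),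
    coef m (mul c v) = if c \in m then coef (m `\ c)%mset v else 0;
  coef_mv : forall w m, coef m (mv w) = (mset_of_seq w == m)%:R;
  Fock_ind_supp : forall (S : {pred key d}) (P : FV -> Prop),
    P 0 -> (forall (a : C) u v, P u -> P v -> P (a *: u + v)) ->
    (forall w, all S w -> P (mv w)) ->
    forall v, (forall m, coef m v != 0 -> all S (enum_mset m)) -> P v
}.

Arguments mul {d F} _ : rename.
Arguments ext {d F} _ : rename.
Arguments coef {d F} _ : rename.
Arguments mul_mv {d F} _ _ : rename.
Arguments mv_perm {d F} [w w'] _ : rename.
Arguments ext_enum {d F} _ _ : rename.
Arguments coef_inj {d F} _ _ _ : rename.
Arguments coef_mul {d F} _ _ _ : rename.
Arguments coef_mv {d F} _ _ : rename.
Arguments Fock_ind_supp {d F} _ _ : rename.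

Definition coefVec d (m : Mon d) : Vec d -> C := mcoeff m.
Lemma coefVec_is_linear d (m : Mon d) : scalar (coefVec m).
Proof. by move=> a u v; rewrite /coefVec mcoeffD mcoeffZ. Qed.
HB.instance Definition _ d (m : Mon d) :=
  GRing.isLinear.Build C (Vec d) C *%R (coefVec m) (coefVec_is_linear m).

(** Transparent, so that operators built on an abstract [Fock] convert to those of the
    definitions. *)
Definition VecFock d : Fock d.
Proof.
refine (@MkFock d (Vec d : lmodType C) (fun c => mulB c : {linear Vec d -> Vec d})
  (@monv d) (fun f => lin f : {linear Vec d -> Vec d})
  (fun m => coefVec m : {scalar Vec d}) (@mulB_monv d) (@monv_perm d)
  (@lin_monv d) _ (@mulB_coef d) _ _).
- by move=> u v /malgP.
- by move=> w m; rewrite /= /coefVec /monv mcoeffU.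
- move=> S P P0 PD Pm v vS; apply: (Vec_ind_supp P0 PD Pm) => m.
  by rewrite -mcoeff_neq0; apply: vS.
Defined.

(** * Creation, replacement and annihilation operators *)

Section Coefficients.
Variables (d : nat) (F : Fock d) (m : Mon d).
Implicit Types u v : F.
Lemma coefD u v : coef m (u + v) = coef m u + coef m v.
Proof. exact: linearD. Qed.
Lemma coefN u : coef m (- u) = - coef m u. Proof. exact: linearN. Qed.
Lemma coefZ a u : coef m (a *: u) = a * coef m u. Proof. exact: scalarZ. Qed.
Lemma coef0 : coef m (0 : F) = 0. Proof. exact: linear0. Qed.
End Coefficients.

(* [ring] does not know modules: compare coefficients. *)
Ltac vring := apply: coef_inj => ?; rewrite ?(coefD, coefN, coefZ, coef0); ring.

(* The label (i, p) stands for the creation operator v^i(-(p+1)), so that the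
   basis elements v^{ij}(m,n), m, n < 0, are the unordered pairs of labels. *)
Definition Lab (d : nat) : Type := ('I_d * nat)%type.
HB.instance Definition _ d := Choice.on (Lab d).

Definition dl d (a b : Lab d) : C := (a == b)%:R.

Definition xk d (a b : Lab d) : key d :=
  (nrm (a.1, b.1, Negz a.2, Negz b.2)).1.
Definition lab1 d (k : key d) : Lab d := (k.1.1.1, `|k.1.2|%N.-1).
Definition lab2 d (k : key d) : Lab d := (k.1.1.2, `|k.2|%N.-1).

Section Operators.
Variable d : nat.
Variable r : C.
Variable F : Fock d.
Local Notation V := (FV F).
Local Notation mv := (@mv d F).
Local Notation mB := (@mul d F).
Local Notation vc := (mv [::]).
Local Notation key := (key d).
Local Notation L := (Lab d).
Implicit Types (a b c e p q : L) (k : key) (u v : V) (w : seq key).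

Lemma dlC a b : dl a b = dl b a. Proof. by rewrite /dl eq_sym. Qed.
Lemma dlxx a : dl a a = 1. Proof. by rewrite /dl eqxx. Qed.
Lemma dl_neq a b : a != b -> dl a b = 0.
Proof. by rewrite /dl => /negPf ->. Qed.

Lemma xkC a b : xk a b = xk b a.
Proof.
case: a b => [i m] [j n]; rewrite /xk /nrm /=.
case: (ltngtP i j) => [lij|lji|eij] //=.
have {eij} <- : i = j by apply: val_inj.
case: (lerP (Negz m) (Negz n)) => h1; case: (lerP (Negz n) (Negz m)) => h2 //=.
  by congr (_, _, _, _); apply/eqP; rewrite eq_le ?h1 ?h2.
by have := lt_trans h1 h2; rewrite ltxx.
Qed.

Lemma inBminus_xk a b : inBminus (xk a b).
Proof.
case: a b => [i m] [j n]; rewrite /xk /nrm /=.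
case: (ltngtP i j) => [lij|lji|eij] //=; rewrite ?lij ?lji //.
have {eij} <- : i = j by apply: val_inj.
by case: lerP => h; rewrite /= eqxx ?h ?(ltW h) ?orbT.
Qed.

(** A basis element remembers its two labels only up to order; hence the recursions below are
    symmetric in [lab1] and [lab2]. *)
Lemma lab_xk a b :
  (lab1 (xk a b) = a /\ lab2 (xk a b) = b) \/
  (lab1 (xk a b) = b /\ lab2 (xk a b) = a).
Proof.
case: a b => [i m] [j n]; rewrite /xk /nrm /lab1 /lab2 /=.
case: (ltngtP i j) => [_|_|eij] /=; [by left|by right|].
have {eij} <- : i = j by apply: val_inj.
by case: lerP => _; [left|right].
Qed.

Lemma xk_lab k : inBminus k -> xk (lab1 k) (lab2 k) = k.
Proof.
case: k => [[[i j] m] n]; rewrite /inBminus /inB /xk /lab1 /lab2 /=.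
case: m n => [m|m] [n|n]; rewrite ?andbF //=.
move=> /andP[/andP[/orP[lij|/andP[/eqP <- le]] _] _]; rewrite /nrm /=.
  by rewrite lij.
by rewrite ltnn le.
Qed.

Lemma xk_inj a b c e :
  xk a b = xk c e -> (a = c /\ b = e) \/ (a = e /\ b = c).
Proof.
by move=> h; have := lab_xk a b; rewrite h;
  case: (lab_xk c e) => -[-> ->] [] [-> ->]; [left|right|right|left].
Qed.

Lemma Fock_mono_ind (P : V -> Prop) :
  P 0 -> (forall (a : C) u v, P u -> P v -> P (a *: u + v)) ->
  (forall w, P (mv w)) -> forall v, P v.
Proof.
move=> P0 PD Pm v; apply: (@Fock_ind_supp _ F predT P P0 PD) => [w _|m _] //.
exact/allP.
Qed.

Lemma Fock_ind (P : V -> Prop) :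
  P 0 -> (forall (a : C) u v, P u -> P v -> P (a *: u + v)) ->
  P vc -> (forall k v, P v -> P (mB k v)) -> forall v, P v.
Proof.
move=> P0 PD Pv Pc; apply: Fock_mono_ind => //.
by elim=> [|c w IH] //; rewrite -mul_mv; apply: Pc.
Qed.

Lemma ext_mv (f : seq key -> V) w :
  (forall w1 w2, perm_eq w1 w2 -> f w1 = f w2) -> ext f (mv w) = f w.
Proof. by move=> fP; rewrite ext_enum; apply/fP/perm_mset_of_seq. Qed.

Lemma linear_ext (f g : {linear V -> V}) :
  (forall w, f (mv w) = g (mv w)) -> forall v, f v = g v.
Proof.
move=> fg; elim/Fock_mono_ind => [|a u v fu fv|w]; last exact: fg.
- by rewrite !linear0.
- by rewrite !linearP fu fv.
Qed.

Lemma mBD k u v : mB k (u + v) = mB k u + mB k v. Proof. exact: linearD. Qed.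
Lemma mBZ k x v : mB k (x *: v) = x *: mB k v. Proof. exact: linearZZ. Qed.
Lemma mBN k v : mB k (- v) = - mB k v. Proof. exact: linearN. Qed.

Lemma mBC k l v : mB k (mB l v) = mB l (mB k v).
Proof.
apply: (linear_ext (f := mB k \o mB l) (g := mB l \o mB k)) => w /=.
by rewrite !mul_mv; apply: mv_perm; rewrite (perm_catCA [:: k] [:: l]).
Qed.

Fixpoint Ew a b w : V :=
  if w is k :: w' then
    mB k (Ew a b w') + dl a (lab1 k) *: mB (xk b (lab2 k)) (mv w')
    + dl a (lab2 k) *: mB (xk (lab1 k) b) (mv w')
  else 0.

(* [opE a b] is the derivation replacing the label [a] by [b]. *)
Definition opE a b : {linear V -> V} := ext (Ew a b).

Lemma opED a b u v : opE a b (u + v) = opE a b u + opE a b v.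
Proof. exact: linearD. Qed.
Lemma opEZ a b x v : opE a b (x *: v) = x *: opE a b v.
Proof. exact: linearZZ. Qed.

Lemma opE_mv a b w : opE a b (mv w) = Ew a b w.
Proof.
apply: ext_mv; apply: perm_invariant => /= [k w1 w2 -> h|k l w0].
  by rewrite (mv_perm h).
rewrite !(mBD, mBZ) (mBC k l) (mBC k (xk b _)) (mBC k (xk _ b)).
by rewrite (mBC l (xk b _)) (mBC l (xk _ b)) -!mul_mv; vring.
Qed.

Lemma opE_vac a b : opE a b (vc) = 0.
Proof. exact: (opE_mv a b [::]). Qed.

Lemma opE_mB a b k v : opE a b (mB k v) =
  mB k (opE a b v) + dl a (lab1 k) *: mB (xk b (lab2 k)) v
  + dl a (lab2 k) *: mB (xk (lab1 k) b) v.
Proof.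
elim/Fock_mono_ind: v => [|x u v IHu IHv|w].
- by rewrite !linear0 ?scaler0 !addr0.
- by rewrite !(mBD, mBZ, opED, opEZ) IHu IHv; vring.
- by rewrite mul_mv !opE_mv.
Qed.

Lemma opE_X a b c e v : opE a b (mB (xk c e) v) =
  mB (xk c e) (opE a b v) + dl a c *: mB (xk b e) v
  + dl a e *: mB (xk c b) v.
Proof.
rewrite opE_mB; case: (lab_xk c e) => -[-> ->] //.
by rewrite (xkC b c) (xkC e b) -!addrA [_ *: _ + _]addrC.
Qed.

(** From b c P = c (b P) + [b,c] P: this is v^{ij}(m,n), m, n > 0, divided by mn. Its bracket with
    an element of B_- consists of four replacements and a multiple of r. *)
Fixpoint Dw a b w : V :=
  if w is k :: w' then
    mB k (Dw a b w')
    + dl a (lab1 k) *: opE b (lab2 k) (mv w')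
    + dl a (lab2 k) *: opE b (lab1 k) (mv w')
    + dl b (lab1 k) *: opE a (lab2 k) (mv w')
    + dl b (lab2 k) *: opE a (lab1 k) (mv w')
    + (r * (dl a (lab1 k) * dl b (lab2 k) + dl a (lab2 k) * dl b (lab1 k)))
        *: mv w'
  else 0.

Definition opD a b : {linear V -> V} := ext (Dw a b).

Lemma opDD a b u v : opD a b (u + v) = opD a b u + opD a b v.
Proof. exact: linearD. Qed.
Lemma opDZ a b x v : opD a b (x *: v) = x *: opD a b v.
Proof. exact: linearZZ. Qed.

Lemma opD_mv a b w : opD a b (mv w) = Dw a b w.
Proof.
apply: ext_mv; apply: perm_invariant => /= [k w1 w2 -> h|k l w0].
  by rewrite (mv_perm h).
rewrite -!mul_mv !opE_mB !(mBD, mBZ) (mBC k l).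
rewrite (xkC (lab1 k) (lab1 l)) (xkC (lab2 k) (lab2 l)).
by vring.
Qed.

Lemma opD_vac a b : opD a b (vc) = 0.
Proof. exact: (opD_mv a b [::]). Qed.

Lemma opD_mB a b k v : opD a b (mB k v) =
  mB k (opD a b v)
  + dl a (lab1 k) *: opE b (lab2 k) v + dl a (lab2 k) *: opE b (lab1 k) v
  + dl b (lab1 k) *: opE a (lab2 k) v + dl b (lab2 k) *: opE a (lab1 k) v
  + (r * (dl a (lab1 k) * dl b (lab2 k) + dl a (lab2 k) * dl b (lab1 k))) *: v.
Proof.
elim/Fock_mono_ind: v => [|x u v IHu IHv|w].
- by rewrite !linear0 ?scaler0 !addr0.
- by rewrite !(mBD, mBZ, opED, opEZ, opDD, opDZ) IHu IHv; vring.
- by rewrite mul_mv !opD_mv.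
Qed.

Lemma opD_X a b c e v : opD a b (mB (xk c e) v) =
  mB (xk c e) (opD a b v)
  + dl a c *: opE b e v + dl a e *: opE b c v
  + dl b c *: opE a e v + dl b e *: opE a c v
  + (r * (dl a c * dl b e + dl a e * dl b c)) *: v.
Proof. by rewrite opD_mB; case: (lab_xk c e) => -[-> ->] //; vring. Qed.

Fixpoint Pw a b w : V :=
  if w is k :: w' then
    mB k (Pw a b w')
    + (dl a (lab1 k) * dl b (lab2 k) + dl a (lab2 k) * dl b (lab1 k)) *: mv w'
  else 0.

(* The partial derivative with respect to [xk a b], doubled when [a = b]. *)
Definition opP a b : {linear V -> V} := ext (Pw a b).

Lemma opPD a b u v : opP a b (u + v) = opP a b u + opP a b v.
Proof. exact: linearD. Qed.
Lemma opPZ a b x v : opP a b (x *: v) = x *: opP a b v.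
Proof. exact: linearZZ. Qed.

Lemma opP_mv a b w : opP a b (mv w) = Pw a b w.
Proof.
apply: ext_mv; apply: perm_invariant => /= [k w1 w2 -> h|k l w0].
  by rewrite (mv_perm h).
by rewrite !(mBD, mBZ) (mBC k l) -!mul_mv; vring.
Qed.

Lemma opP_vac a b : opP a b (vc) = 0.
Proof. exact: (opP_mv a b [::]). Qed.

Lemma opP_mB a b k v : opP a b (mB k v) =
  mB k (opP a b v)
  + (dl a (lab1 k) * dl b (lab2 k) + dl a (lab2 k) * dl b (lab1 k)) *: v.
Proof.
elim/Fock_mono_ind: v => [|x u v IHu IHv|w].
- by rewrite !linear0 ?scaler0 !addr0.
- by rewrite !(mBD, mBZ, opED, opEZ, opDD, opDZ, opPD, opPZ) IHu IHv; vring.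
- by rewrite mul_mv !opP_mv.
Qed.

Lemma opP_X a b c e v : opP a b (mB (xk c e) v) =
  mB (xk c e) (opP a b v) + (dl a c * dl b e + dl a e * dl b c) *: v.
Proof. by rewrite opP_mB; case: (lab_xk c e) => -[-> ->] //; vring. Qed.

Let linE := (mBD, mBZ, mBN, opED, opEZ, opDD, opDZ, opPD, opPZ).
Let lin0 := (linear0, scaler0, addr0, subr0, opE_vac, opD_vac, opP_vac).
Let allE := (opE_X, opD_X, opP_X, linE, opE_mB, opD_mB, opP_mB).

Lemma opD_sym a b v : opD a b v = opD b a v.
Proof.
elim/Fock_ind: v => [|x u v IHu IHv||k v IH].
- by rewrite !lin0.
- by rewrite !linE IHu IHv.
- by rewrite !lin0.
- by rewrite !opD_mB IH; vring.
Qed.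

Lemma opP_sym a b v : opP a b v = opP b a v.
Proof.
elim/Fock_ind: v => [|x u v IHu IHv||k v IH].
- by rewrite !lin0.
- by rewrite !linE IHu IHv.
- by rewrite !lin0.
- by rewrite !opP_mB IH; vring.
Qed.

Lemma opP_comm a b p q v : opP a b (opP p q v) = opP p q (opP a b v).
Proof.
elim/Fock_ind: v => [|x u v IHu IHv||k v IH].
- by rewrite !lin0.
- by rewrite !linE IHu IHv.
- by rewrite !lin0.
- by rewrite !allE IH; vring.
Qed.

Lemma opE_opE a b p q v : opE a b (opE p q v) =
  opE p q (opE a b v) + dl a q *: opE p b v - dl p b *: opE a q v.
Proof.
elim/Fock_ind: v => [|x u v IHu IHv||k v IH].
- by rewrite !lin0.
- by rewrite !linE IHu IHv; vring.
- by rewrite !lin0.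
- by rewrite !allE IH !linE; vring.
Qed.

Lemma opD_opE p q a b v : opD p q (opE a b v) =
  opE a b (opD p q v) + dl p b *: opD a q v + dl q b *: opD a p v.
Proof.
elim/Fock_ind: v => [|x u v IHu IHv||k v IH].
- by rewrite !lin0.
- by rewrite !linE IHu IHv; vring.
- by rewrite !lin0.
- by rewrite !allE IH !linE !(opE_opE a b); vring.
Qed.

Lemma opP_opE p q a b v : opP p q (opE a b v) =
  opE a b (opP p q v) + dl p b *: opP a q v + dl q b *: opP a p v.
Proof.
elim/Fock_ind: v => [|x u v IHu IHv||k v IH].
- by rewrite !lin0.
- by rewrite !linE IHu IHv; vring.
- by rewrite !lin0.
- by rewrite !allE IH !linE; vring.
Qed.

(** [opD a b] is [r *: opP a b] plus a second order operator with linear coefficients. Only the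
    latter contributes, so r is absent, and b trades places with p or with q. *)
Lemma opP_opD p q a b v : opP p q (opD a b v) =
  opD a b (opP p q v) + opP a p (opP b q v) + opP a q (opP b p v).
Proof.
elim/Fock_ind: v => [|x u v IHu IHv||k v IH].
- by rewrite !lin0.
- by rewrite !linE IHu IHv; vring.
- by rewrite !lin0.
- by rewrite !allE IH !linE !opP_opE; vring.
Qed.

End Operators.

(** * Vectors killed by all annihilation operators *)

Section JucysMurphy.
Variable T : Type.
Implicit Types (f : (nat -> T) -> C) (W : nat -> T) (c : C).

Definition swp (i j x : nat) : nat :=
  if x == i then j else if x == j then i else x.

(* The action of the Jucys-Murphy element (0 k) + ... + (k-1 k). *)
Definition jm (k : nat) f W : C := \sum_(t < k) f (W \o swp t k).

Lemma swpK i j : swp i j \o swp i j = id.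
Proof.
apply: functional_extensionality => x; rewrite /swp /=.
by do !case: eqP => //=; lia.
Qed.

Lemma swp_conj t u k : (t < k)%N -> (u < k.+1)%N ->
  swp t k \o swp u k.+1 = swp (swp t k u) k.+1 \o swp t k.
Proof.
move=> tk uk; apply: functional_extensionality => x; rewrite /swp /=.
by do !case: eqP => //=; lia.
Qed.

Lemma swp_lt t k u : (t < k)%N -> (u < k.+1)%N -> (swp t k u < k.+1)%N.
Proof. by move=> tk uk; rewrite /swp; do !case: eqP => //=; lia. Qed.

(** Conjugation by (t k), t < k, permutes the transpositions (u k+1), u <= k, and so fixes their
    sum. *)
Lemma jm_comm k f W : jm k (jm k.+1 f) W = jm k.+1 (jm k f) W.
Proof.
rewrite /jm exchange_big [RHS]exchange_big /= exchange_big.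
apply: eq_bigr => t _.
pose h (u : 'I_k.+1) : 'I_k.+1 := inord (swp t k u).
have hE u : h u = swp t k u :> nat by rewrite inordK // swp_lt.
have hK : cancel h h.
  by move=> u; apply: val_inj; rewrite /= !hE; apply: (congr1 (@^~ (val u)) (swpK t k)).
rewrite [RHS](reindex_inj (can_inj hK)) /=; apply: eq_bigr => u _.
congr (f _); have := swp_conj (ltn_ord t) (ltn_ord u) => e.
by rewrite -[LHS]/(W \o (swp t k \o swp u k.+1)) e hE.
Qed.

(** The degenerate affine Hecke relation. Conjugating (t k+1), t < k, by (k k+1) gives (t k); the
    extra [f W] comes from the last transposition, whose square is 1. *)
Lemma jm_succ k f W :
  jm k.+1 f (W \o swp k k.+1) = jm k (fun W => f (W \o swp k k.+1)) W + f W.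
Proof.
rewrite /jm big_ord_recr /=; congr (_ + f _); last first.
  by rewrite -[LHS]/(W \o (swp k k.+1 \o swp k k.+1)) swpK.
apply: eq_bigr => t _; congr (f _).
rewrite -[LHS]/(W \o (swp k k.+1 \o swp t k.+1)).
rewrite -[RHS]/(W \o (swp t k \o swp k k.+1)); congr (W \o _).
have tk := ltn_ord t.
apply: functional_extensionality => x; rewrite /swp /=.
by do !case: eqP => //=; lia.
Qed.

Lemma jm_lin k c f g W :
  jm k (fun W => f W + c * g W) W = jm k f W + c * jm k g W.
Proof. by rewrite /jm mulr_sumr -big_split. Qed.

Lemma jm_eq k f g W : (forall W, f W = g W) -> jm k f W = jm k g W.
Proof. by move=> fg; apply: eq_bigr => t _; apply: fg. Qed.

(* With J = J_k, J' = J_(k+1), s = (k k+1) and J' f = c f, the relation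
   s J' = J s + 1 gives (J - c) s f = - f; as J and J' commute, induction yields
   J' (s f) = c (s f), hence (J - c)^2 f = f, and J has no eigenvalue c +- 1. *)
Lemma jm_nonint k c f : (forall z : int, c <> z%:~R) ->
  (forall W, jm k f W = c * f W) -> forall W, f W = 0.
Proof.
elim: k c f => [|k IH] c f cZ Jf W.
  have := Jf W; rewrite /jm big_ord0 => /esym/eqP; rewrite mulf_eq0.
  by case/orP => [/eqP c0|/eqP //]; case: (cZ 0).
pose s W : nat -> T := W \o swp k k.+1; pose sf W := f (s W).
have ssf W' : sf (s W') = f W'.
  by rewrite /sf /s -[_ \o _]/(W' \o (swp k k.+1 \o swp k k.+1)) swpK.
have H1 W' : jm k sf W' = c * sf W' - f W'.
  by have := jm_succ k f W'; rewrite Jf -/(sf _) => ->; rewrite addrK.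
have H2 W' : jm k.+1 sf W' + - c * sf W' = 0.
  move: W'; apply: (IH c) => // W'; rewrite jm_lin jm_comm H1.
  have -> : jm k.+1 (jm k sf) W' = c * jm k.+1 sf W' + - 1 * jm k.+1 f W'.
    have -> : c * jm k.+1 sf W' = jm k.+1 (fun W => c * sf W) W'.
      by rewrite /jm mulr_sumr.
    by rewrite -jm_lin; apply: jm_eq => W''; rewrite H1 mulN1r.
  by rewrite Jf; ring.
have H3 W' : jm k f W' = c * f W' - sf W'.
  have := jm_succ k sf W'.
  have -> : jm k.+1 sf (W' \o swp k k.+1) = c * sf (s W').
    by apply/eqP; rewrite -subr_eq0 -mulNr; apply/eqP/H2.
  rewrite ssf => ->; rewrite addrK; apply: jm_eq => W''.
  by rewrite -/(s W'') ssf.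
have H4 W' : f W' + - 1 * sf W' = 0.
  move: W'; apply: (IH (c + 1)) => [z cz|W'].
    by apply: (cZ (z - 1)); rewrite intrB -cz addrK.
  by rewrite jm_lin H3 H1; ring.
apply: (IH (c - 1)) => [z cz|W'].
  by apply: (cZ (z + 1)); rewrite intrD -cz subrK.
rewrite H3; have /eqP := H4 W'; rewrite mulN1r subr_eq0 => /eqP <-; ring.
Qed.

End JucysMurphy.

(** * Taylor coefficients of vectors of M_r *)

Section GoodVectors.
Variables (d : nat) (r : C) (F : Fock d).
Local Notation V := (FV F).
Local Notation key := (key d).
Local Notation L := (Lab d).
Local Notation vc := (@mv d F [::]).
Implicit Types (a b c e p q : L) (k : key) (u v : V) (w : seq key).

(** [Vec] also contains monomials in keys outside B_-; the good vectors form M_r proper. *)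
Definition good v : Prop :=
  forall m, coef m v != 0 -> all (@inBminus d) (enum_mset m).

Lemma good0 : good 0. Proof. by move=> m; rewrite coef0 eqxx. Qed.

Lemma good_lin x u v : good u -> good v -> good (x *: u + v).
Proof.
move=> gu gv m; rewrite coefD coefZ.
case: (eqVneq (coef m u) 0) => [->|/gu //].
by rewrite mulr0 add0r => /gv.
Qed.

Lemma goodD u v : good u -> good v -> good (u + v).
Proof. by move=> gu gv; rewrite -[u]scale1r; apply: good_lin. Qed.

Lemma goodZ x v : good v -> good (x *: v).
Proof. by move=> gv; rewrite -[_ *: _]addr0; apply: good_lin good0. Qed.

Lemma good_mB k v : inBminus k -> good v -> good (mul k v).
Proof.
move=> gk gv m; rewrite coef_mul; case: ifP; last by rewrite eqxx.
move=> km /gv /allP h; apply/allP => x xm.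
case: (eqVneq x k) => [-> //|xk]; apply: h.
by rewrite in_msetB1 (negPf xk).
Qed.

Lemma good_mv w : all (@inBminus d) w -> good (mv F w).
Proof.
elim: w => [_|k w IH /= /andP[gk gw]].
  move=> m; rewrite coef_mv.
  case: (eqVneq (mset_of_seq [::]) m) => [<- _|_]; last by rewrite eqxx.
  by rewrite enum_mset0.
by rewrite -mul_mv; apply: good_mB => //; apply: IH.
Qed.

Lemma good_ind (P : V -> Prop) :
  P 0 -> (forall (x : C) u v, P u -> P v -> P (x *: u + v)) ->
  P vc -> (forall k v, inBminus k -> good v -> P v -> P (mul k v)) ->
  forall v, good v -> P v.
Proof.
move=> P0 PD Pv Pc v gv; apply: (Fock_ind_supp _ P P0 PD) gv => w.
elim: w => [|k w IH] //= /andP[gk gw]; rewrite -mul_mv.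
by apply: Pc => //; [apply: good_mv|apply: IH].
Qed.

Lemma good_X a b v : good v -> good (mul (xk a b) v).
Proof. by apply: good_mB; apply: inBminus_xk. Qed.

Lemma good_opE a b v : good v -> good (opE F a b v).
Proof.
move=> gv; elim/good_ind: gv => [|x u1 u2 h1 h2||k u gk gu h].
- by rewrite linear0; apply: good0.
- by rewrite opED opEZ; apply: good_lin.
- by rewrite opE_vac; apply: good0.
- rewrite opE_mB; apply: goodD; first apply: goodD.
  + exact: good_mB.
  + by apply: goodZ; apply: good_X.
  + by apply: goodZ; apply: good_X.
Qed.

Lemma good_opD a b v : good v -> good (opD r F a b v).
Proof.
move=> gv; elim/good_ind: gv => [|x u1 u2 h1 h2||k u gk gu h].
- by rewrite linear0; apply: good0.
- by rewrite opDD opDZ; apply: good_lin.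
- by rewrite opD_vac; apply: good0.
- rewrite opD_mB; apply: goodD; last exact: goodZ.
  do !apply: goodD; try by apply: goodZ; apply: good_opE.
  exact: good_mB.
Qed.

Lemma good_opP a b v : good v -> good (opP F a b v).
Proof.
move=> gv; elim/good_ind: gv => [|x u1 u2 h1 h2||k u gk gu h].
- by rewrite linear0; apply: good0.
- by rewrite opPD opPZ; apply: good_lin.
- by rewrite opP_vac; apply: good0.
- by rewrite opP_mB; apply: goodD; [exact: good_mB|exact: goodZ].
Qed.

Lemma dl_pair a b k : inBminus k ->
  dl a (lab1 k) * dl b (lab2 k) + dl a (lab2 k) * dl b (lab1 k) =
  (1 + dl a b) * (k == xk a b)%:R.
Proof.
move=> gk; case: eqP => [->|ne].
  case: (lab_xk a b) => -[-> ->]; rewrite !dlxx (dlC b a) !mulr1 ?mul1r.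
    by rewrite /dl; case: eqP; rewrite /= ?mulr1 ?mulr0.
  by rewrite /dl addrC; case: eqP; rewrite /= ?mulr1 ?mulr0.
rewrite mulr0 /dl; case: (eqVneq a (lab1 k)) => [a1|_].
  case: (eqVneq b (lab2 k)) => [b2|_]; first by case: ne; rewrite a1 b2 xk_lab.
  rewrite mulr0 add0r; case: (eqVneq a (lab2 k)) => [a2|_]; rewrite ?mul0r //.
  case: (eqVneq b (lab1 k)) => [b1|_]; rewrite ?mulr0 //.
  by case: ne; rewrite a2 b1 xkC xk_lab.
rewrite mul0r add0r; case: (eqVneq a (lab2 k)) => [a2|_]; rewrite ?mul0r //.
case: (eqVneq b (lab1 k)) => [b1|_]; rewrite ?mulr0 //.
by case: ne; rewrite a2 b1 xkC xk_lab.
Qed.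

Lemma coef_opP a b v m : good v ->
  coef m (opP F a b v) =
  (1 + dl a b) * (m (xk a b)).+1%:R * coef (xk a b +` m)%mset v.
Proof.
move=> gv; elim/good_ind: gv m => [|x u1 u2 h1 h2||k u gk gu h] m.
- by rewrite linear0 !coef0 mulr0.
- by rewrite opPD opPZ !coefD !coefZ h1 h2; ring.
- rewrite opP_vac coef0 coef_mv.
  case: eqP => [e|_]; last by rewrite mulr0.
  have : xk a b \in (xk a b +` m)%mset by apply: mset1D1.
  by rewrite -e in_mset0.
rewrite opP_mB coefD coefZ dl_pair // !coef_mul in_mset1D.
case: (eqVneq k (xk a b)) => [->|ne] /=.
  rewrite msetD1K mulr1; case: ifP => [xm|xm].
    rewrite h msetB1K // msetB1E eqxx subn1 prednK; last by rewrite mset_gt0.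
    by rewrite -[in RHS]addn1 natrD; ring.
  have -> : m (xk a b) = 0%N by apply/eqP; rewrite mset_eq0 xm.
  by rewrite add0r mulr1.
rewrite mulr0 mul0r addr0; case: ifP => km; last by rewrite mulr0.
rewrite h msetB1E (eq_sym (xk a b)) (negPf ne) subn0.
suff -> : (xk a b +` (m `\ k) = (xk a b +` m) `\ k)%mset by [].
apply/msetP => x; rewrite msetB1E !mset1DE msetB1E.
have : (0 < m k)%N by rewrite mset_gt0.
by case: (eqVneq x k) => [->|_]; rewrite ?subn0 // (negPf ne) !add0n.
Qed.

(** A Taylor coefficient at 0, the pairs (W 2i, W (2i+1)), i < n, naming the derivatives. Viewed as
    a function of the word, it is acted on by permutations that break up the pairs; words indexed by
    all of [nat] serve every n at once. *)
Fixpoint Fn (n : nat) (W : nat -> L) v : C :=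
  if n is n'.+1 then Fn n' W (opP F (W n'.*2) (W n'.*2.+1) v)
  else coef mset0 v.

Definition upd (W : nat -> L) (t : nat) b : nat -> L :=
  fun x => if x == t then b else W x.

Lemma Fn_ext n W W' v : (forall i, (i < n.*2)%N -> W i = W' i) ->
  Fn n W v = Fn n W' v.
Proof.
elim: n v => //= n IH v WW'; rewrite !WW' ?doubleS //.
by apply: IH => i ilt; apply: WW'; rewrite doubleS !ltnS ltnW // ltnW.
Qed.

Lemma Fn_lin n W x u v : Fn n W (x *: u + v) = x * Fn n W u + Fn n W v.
Proof.
elim: n u v => [|n IH] u v /=; first by rewrite coefD coefZ.
by rewrite opPD opPZ IH.
Qed.
Lemma Fn0 n W : Fn n W 0 = 0.
Proof. by elim: n => [|n IH] /=; rewrite ?coef0 // linear0. Qed.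
Lemma FnD n W u v : Fn n W (u + v) = Fn n W u + Fn n W v.
Proof. by rewrite -[u]scale1r Fn_lin mul1r scale1r. Qed.

Lemma eps_mul k v : coef mset0 (mul k v) = 0.
Proof. by rewrite coef_mul in_mset0. Qed.

Lemma eps_opE a b v : coef mset0 (opE F a b v) = 0.
Proof.
elim/Fock_ind: v => [|x u v IHu IHv||k v IH].
- by rewrite linear0 coef0.
- by rewrite opED opEZ coefD coefZ IHu IHv mulr0 addr0.
- by rewrite opE_vac coef0.
- by rewrite opE_mB !coefD !coefZ !eps_mul !mulr0 !addr0.
Qed.

Lemma eps_opD a b v :
  coef mset0 (opD r F a b v) = r * coef mset0 (opP F a b v).
Proof.
elim/Fock_ind: v => [|x u v IHu IHv||k v IH].
- by rewrite !linear0 ?coef0 ?mulr0.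
- by rewrite opDD opDZ opPD opPZ !coefD !coefZ IHu IHv; ring.
- by rewrite opD_vac opP_vac coef0 mulr0.
- by rewrite opD_mB opP_mB !coefD !coefZ !eps_mul !eps_opE; ring.
Qed.

(* For a vector killed by all [opD a b], this says that the function [Fn n.+1]
   of the word of labels is an eigenvector of [jm n.*2] of eigenvalue -r. *)
Lemma Fn_opD n W a b v :
  Fn n W (opD r F a b v) = r * Fn n W (opP F a b v)
    + \sum_(t < n.*2) Fn n (upd W t b) (opP F a (W t) v).
Proof.
elim: n v => [|n IH] v /=; first by rewrite big_ord0 addr0 eps_opD.
set p := W _; set q := W _.
(* The commutator in [opP_opD] supplies the two new summands, at the positions of p and q. *)
rewrite opP_opD !FnD IH doubleS !big_ord_recr /= (opP_comm _ _ p) -!addrA.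
have updN t i : i != t -> upd W t b i = W i by rewrite /upd => /negPf ->.
congr (_ + _); congr (_ + _); last congr (_ + _).
- apply: eq_bigr => t _; have tn := ltn_ord t.
  by rewrite !updN ?(opP_comm _ _ p) //; lia.
- rewrite -/p (opP_comm a p); have -> : upd W n.*2 b n.*2 = b by rewrite /upd eqxx.
  rewrite updN -/q; last by lia.
  by apply: Fn_ext => i ilt; rewrite updN //; lia.
- rewrite -/q (opP_comm a q).
  have -> : upd W n.*2.+1 b n.*2.+1 = b by rewrite /upd eqxx.
  rewrite updN -/p ?(opP_sym _ p); last by lia.
  by apply: Fn_ext => i ilt; rewrite updN //; lia.
Qed.

Lemma Fn_harmonic n W v : (forall z : int, r <> z%:~R) ->
  (forall a b, opD r F a b v = 0) -> Fn n.+1 W v = 0.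
Proof.
move=> rZ Dv.
apply: (jm_nonint (k := n.*2) (c := - r) (f := fun W => Fn n.+1 W v)) => [z rz|W'].
  by apply: (rZ (- z)); rewrite intrN -rz opprK.
(* With the last two labels as a and b, putting b at position t and pairing a with the old label
   amounts to the transposition of t and [n.*2]. *)
have := Fn_opD n W' (W' n.*2.+1) (W' n.*2) v; rewrite Dv Fn0 => /esym/eqP.
rewrite addrC addr_eq0 -mulNr => /eqP; rewrite /= (opP_sym _ (W' n.*2)) => <-.
apply: eq_bigr => t _; have tn := ltn_ord t.
have -> : (W' \o swp t n.*2) n.*2 = W' t.
  by rewrite /= /swp gtn_eqF ?eqxx.
have -> : (W' \o swp t n.*2) n.*2.+1 = W' n.*2.+1.
  by rewrite /= /swp; do !case: eqP => //=; lia.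
rewrite opP_sym; apply: Fn_ext => i ilt; rewrite /= /swp /upd.
by do !case: eqP => //=; lia.
Qed.

Lemma one_dl_neq0 a b : 1 + dl a b != 0.
Proof.
rewrite /dl; case: (a =P b) => _; first by rewrite nat1r natC_neq0.
by rewrite addr0 oner_eq0.
Qed.

(** The multiplicities in [coef_opP] are nonzero in characteristic 0, so the derivatives along the
    letters of w isolate its coefficient. [W0] supplies a word to start from, as the type of labels
    may be empty. *)
Lemma Fn_nondegenerate (W0 : nat -> L) w v : good v -> all (@inBminus d) w ->
  (forall W, Fn (size w) W v = 0) -> coef (mset_of_seq w) v = 0.
Proof.
elim: w v => [|k w IH] v gv /=; first by move=> _ /(_ W0).
move=> /andP[gk gw] Fv; pose a := lab1 k; pose b := lab2 k.
have kE : k = xk a b by rewrite xk_lab.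
have : coef (mset_of_seq w) (opP F a b v) = 0.
  apply: IH => // [|W]; first exact: good_opP.
  have := Fv (upd (upd W (size w).*2 a) (size w).*2.+1 b).
  rewrite {2 3 4 5 6}/upd !eqxx ltn_eqF // => <-.
  by apply: Fn_ext => i ilt; rewrite /upd !ltn_eqF // ltnW.
rewrite coef_opP // -kE => /eqP; rewrite !mulf_eq0 (negPf (one_dl_neq0 _ _)).
by rewrite (negPf (natC_neq0 _)) => /eqP.
Qed.

Lemma harmonic_const v : (forall z : int, r <> z%:~R) -> good v ->
  (forall a b, opD r F a b v = 0) -> v = coef mset0 v *: vc.
Proof.
move=> rZ gv Dv; apply: coef_inj => m; rewrite coefZ coef_mv /=.
case: eqP => [<-|ne]; first by rewrite mulr1.
rewrite mulr0; apply/eqP; apply/negPn/negP => /[dup] cm /gv gm.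
case/eqP: cm; rewrite -[m]enum_msetK.
case: (enum_mset m) (enum_msetK m) gm => [|k w] e gm; first by case: ne.
apply: (Fn_nondegenerate (fun=> lab1 k)) => // W; exact: Fn_harmonic.
Qed.

End GoodVectors.

(** * Singular vectors at integral level *)

Section Radical.
Variables (d : nat) (r : C) (F : Fock d).
Local Notation V := (FV F).
Local Notation key := (key d).
Local Notation L := (Lab d).
Local Notation vc := (@mv d F [::]).
Local Notation mB := (@mul d F).
Local Notation opE := (opE F).
Local Notation opD := (opD r F).
Implicit Types (a b c e p q x : L) (k : key) (u v : V) (w : seq key).

(* [null v]: v lies in the radical of the contravariant form of M_r, in which
   the [opD a b] are adjoint to the multiplications by [xk a b]. *)
Fixpoint epsD (ds : seq (L * L)) v : C :=
  if ds is p :: ds' then epsD ds' (opD p.1 p.2 v) else coef mset0 v.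

Definition null v : Prop := forall ds, epsD ds v = 0.

Lemma epsD_lin ds (x : C) u v :
  epsD ds (x *: u + v) = x * epsD ds u + epsD ds v.
Proof.
elim: ds u v => [|p ds IH] u v /=; first by rewrite coefD coefZ.
by rewrite opDD opDZ IH.
Qed.

Lemma null_lin (x : C) u v : null u -> null v -> null (x *: u + v).
Proof. by move=> nu nv ds; rewrite epsD_lin nu nv mulr0 addr0. Qed.

Lemma null0 : null 0.
Proof. by elim=> [|p ds IH] /=; rewrite ?coef0 // linear0. Qed.

Lemma nullD u v : null u -> null v -> null (u + v).
Proof. by move=> nu nv; rewrite -[u]scale1r; apply: null_lin. Qed.

Lemma nullZ (x : C) v : null v -> null (x *: v).
Proof. by move=> nv; rewrite -[_ *: _]addr0; apply: null_lin null0. Qed.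

Lemma null_opD a b v : null v -> null (opD a b v).
Proof. by move=> nv ds; apply: (nv ((a, b) :: ds)). Qed.

Lemma epsDD ds u v : epsD ds (u + v) = epsD ds u + epsD ds v.
Proof. by rewrite -[u]scale1r epsD_lin mul1r scale1r. Qed.

Lemma null_opE a b v : null v -> null (opE a b v).
Proof.
move=> nv ds; elim: ds v nv => [|p ds IH] v nv /=; first exact: eps_opE.
rewrite opD_opE !epsDD IH ?(nullZ _ (null_opD _ _ nv)) ?addr0 //.
exact: null_opD.
Qed.

(** Moving the D's past [xk a b] leaves replacements and scalars, which preserve [null]; thus the
    radical is handled without constructing the form. *)
Lemma null_X a b v : null v -> null (mB (xk a b) v).
Proof.
move=> nv ds; elim: ds v nv => [|p ds IH] v nv /=; first exact: eps_mul.
rewrite opD_X !epsDD IH ?(nullZ _ nv) ?(nullZ _ (null_opE _ _ nv)) ?addr0 //.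
exact: null_opD.
Qed.

Lemma vac_not_null : ~ null vc.
Proof. by move/(_ [::]); rewrite /= coef_mv eqxx => /eqP; rewrite oner_eq0. Qed.

Lemma singular_null v :
  (forall a b, opD a b v = 0) -> coef mset0 v = 0 -> null v.
Proof. by move=> Dv ev [|p ds] //=; rewrite Dv; apply: null0. Qed.

End Radical.

(** * Powers of x_aa and of x_aa x_bb - x_ab^2 *)

Section NegativeLevel.
Variables (d : nat) (r : C) (F : Fock d).
Local Notation V := (FV F).
Local Notation L := (Lab d).
Local Notation vc := (@mv d F [::]).
Local Notation mB := (@mul d F).
Local Notation opE := (opE F).
Local Notation opD := (opD r F).
Variables (a b : L).
Implicit Types (c e x : L) (u v : V) (n : nat).

Definition pw n : V := iter n (mB (xk a a)) vc.

Lemma pwS n : pw n.+1 = mB (xk a a) (pw n). Proof. by []. Qed.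

Lemma opE_pw e n : opE e a (pw n) = (dl e a * n%:R * 2%:R) *: pw n.
Proof.
elim: n => [|n IH] /=; first by rewrite opE_vac mulr0 mul0r scale0r.
by rewrite opE_X IH mBZ -natr1; vring.
Qed.

Lemma opD_pw c e n : opD c e (pw n.+1) =
  (dl c a * dl e a * n.+1%:R * 2%:R * (r + 2%:R * n%:R)) *: pw n.
Proof.
elim: n => [|n IH].
  by rewrite opD_X opD_vac linear0 !opE_vac; vring.
by rewrite pwS opD_X IH !opE_pw mBZ -pwS -[n.+2%:R]natr1 -[n.+1%:R]natr1; vring.
Qed.

Lemma good_pw n : good (pw n).
Proof. by elim: n => [|n IH] /=; [apply: good_mv|apply: good_X]. Qed.

Lemma pw_neq0 n : pw n != 0.
Proof.
have -> : pw n = mv F (nseq n (xk a a)).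
  by elim: n => //= n ->; rewrite mul_mv.
apply/eqP => /(congr1 (coef (mset_of_seq (nseq n (xk a a))))).
by rewrite coef_mv eqxx coef0 => /eqP; rewrite oner_eq0.
Qed.

Lemma pw_null n : r = - (2 * n)%:R -> null r (pw n.+1).
Proof.
move=> rE; apply: singular_null => [c e|]; last exact: eps_mul.
by rewrite opD_pw rE natrM addNr mulr0 scale0r.
Qed.

Hypothesis neq_ab : a != b.

Definition fop v : V :=
  mB (xk a a) (mB (xk b b) v) - mB (xk a b) (mB (xk a b) v).
Definition dt n : V := iter n fop vc.
(** Multiplication by half of [opP c e] of the determinant x_aa x_bb - x_ab^2, that is, by an entry
    of the adjugate matrix when c and e are among a and b, and by 0 otherwise. *)
Definition cofac c e v : V :=
  (dl c a * dl e a) *: mB (xk b b) v + (dl c b * dl e b) *: mB (xk a a) v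
  - (dl c a * dl e b + dl c b * dl e a) *: mB (xk a b) v.

Let opEB e x u v : opE e x (u - v) = opE e x u - opE e x v.
Proof. exact: linearB. Qed.
Let opDB e x u v : opD e x (u - v) = opD e x u - opD e x v.
Proof. exact: linearB. Qed.
Let xkba : xk b a = xk a b. Proof. exact: xkC. Qed.
(** Oriented cases of [mBC], which would loop as a rewrite rule; they sort products of the three
    generators as x_aa, x_ab, x_bb. *)
Let mBab v : mB (xk b b) (mB (xk a b) v) = mB (xk a b) (mB (xk b b) v).
Proof. exact: mBC. Qed.
Let mBaa v : mB (xk a b) (mB (xk a a) v) = mB (xk a a) (mB (xk a b) v).
Proof. exact: mBC. Qed.
Let mBbb v : mB (xk b b) (mB (xk a a) v) = mB (xk a a) (mB (xk b b) v).
Proof. exact: mBC. Qed.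
Let nf := (xkba, mBab, mBaa, mBbb).
Let linX := (mBD, mBZ, mBN).

Lemma fop_cofac c e v : fop (cofac c e v) = cofac c e (fop v).
Proof. by rewrite /fop /cofac !linX !nf; vring. Qed.

Lemma fopZ (x : C) v : fop (x *: v) = x *: fop v.
Proof. by rewrite /fop !linX; vring. Qed.

(** Replacing one label of the determinant by the other makes two rows equal and gives 0; replacing
    a label by itself counts it twice in each factor. *)
Lemma opE_dt e x n : (x == a) || (x == b) ->
  opE e x (dt n) = (dl e x * n%:R * 2%:R) *: dt n.
Proof.
move=> xab; elim: n => [|n IH] /=.
  by rewrite opE_vac mulr0 mul0r scale0r.
rewrite /fop opEB !(opE_X, linX) IH !linX -natr1.
by case/orP: xab => /eqP ->; rewrite !nf; vring.
Qed.

Lemma opD_dt c e n : opD c e (dt n) =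
  (2%:R * n%:R * (r + 2%:R * n%:R - 3%:R)) *: cofac c e (dt n.-1).
Proof.
have aab : (a == a) || (a == b) by rewrite eqxx.
have bab : (b == a) || (b == b) by rewrite eqxx orbT.
elim: n => [|n IH]; first by rewrite opD_vac mulr0 mul0r scale0r.
(* Passing D through one more determinant costs a multiple of the cofactor. Summed over m < n, the
   factors 8m + 2r - 2 give 2n(r + 2n - 3). *)
have H : opD c e (dt n.+1) =
    fop (opD c e (dt n)) + (8%:R * n%:R + 2%:R * r - 2%:R) *: cofac c e (dt n).
  rewrite /= {1}/fop opDB !(opD_X, opE_X, linX).
  rewrite !(opE_dt _ _ aab) !(opE_dt _ _ bab) !linX /fop /cofac !nf.
  by vring.
rewrite H IH fopZ fop_cofac; case: n {IH H} => [|n] /=.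
  by rewrite mulr0 mul0r; vring.
by rewrite -[n.+2%:R]natr1; vring.
Qed.

Lemma good_dt n : good (dt n).
Proof.
elim: n => [|n IH] /=; first exact: good_mv.
rewrite /fop -scaleN1r; apply: goodD; last apply: goodZ.
  by do 2!apply: good_X.
by do 2!apply: good_X.
Qed.

(** The monomial x_aa^n x_bb^n: free of x_ab, it arises only once in the expansion of [dt n], with
    coefficient 1. *)
Fixpoint dtm n : Mon d :=
  if n is n'.+1 then (xk a a +` (xk b b +` dtm n'))%mset else mset0.

Lemma dt_neq0 n : dt n != 0.
Proof.
have ab_aa : xk a b != xk a a.
  by apply/eqP => /xk_inj [] [] e1 e2; move: neq_ab; rewrite ?e1 ?e2 ?eqxx -?e1 ?eqxx.
have ab_bb : xk a b != xk b b.
  by apply/eqP => /xk_inj [] [] e1 e2; move: neq_ab; rewrite ?e1 ?e2 ?eqxx.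
have abm m : (xk a b \in dtm m) = false.
  elim: m => [|m IH]; rewrite /= ?in_mset0 // !in_mset1D IH.
  by rewrite (negPf ab_aa) (negPf ab_bb).
suff /eqP h : coef (dtm n) (dt n) = 1.
  by apply/eqP => e; move: h; rewrite e coef0 eq_sym oner_eq0.
elim: n => [|n IH]; first by rewrite coef_mv eqxx.
rewrite /dt iterS -/(dt n) /fop coefD coefN (coef_mul (xk a b)) abm oppr0 addr0.
by rewrite coef_mul /= mset1D1 msetD1K coef_mul mset1D1 msetD1K.
Qed.

Lemma dt_null n : r = 1 - (2 * n)%:R -> null r (dt n.+1).
Proof.
move=> rE; apply: singular_null => [c e|].
  rewrite opD_dt.
  have -> : r + 2%:R * n.+1%:R - 3%:R = 0 by rewrite rE natrM -natr1; ring.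
  by rewrite mulr0 scale0r.
by rewrite /= /fop coefD coefN !eps_mul subrr.
Qed.

End NegativeLevel.

(* Sealed, so that unification does not compute in the complex numbers. *)
HB.lock Definition sgnp n (s : 'S_n) : C := (-1) ^+ s.

Section Sign.
Variable n : nat.
Implicit Types s t : 'S_n.
Lemma sgnpM s t : sgnp (s * t)%g = sgnp s * sgnp t.
Proof. by rewrite sgnp.unlock odd_permM signr_addb. Qed.
Lemma sgnpV s : sgnp s^-1%g = sgnp s.
Proof. by rewrite sgnp.unlock odd_permV. Qed.
Lemma sgnp1 : sgnp (1%g : 'S_n) = 1.
Proof. by rewrite sgnp.unlock odd_perm1. Qed.
Lemma sgnp_tperm (i j : 'I_n) : i != j -> sgnp (tperm i j) = -1.
Proof. by move=> ij; rewrite sgnp.unlock odd_tperm ij expr1. Qed.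
Lemma sgnp_sq s : sgnp s * sgnp s = 1.
Proof. by rewrite sgnp.unlock -signr_addb addbb. Qed.
End Sign.

Lemma perm_map_perm (T : eqType) n (G : 'I_n -> T) (t : 'S_n) :
  perm_eq [seq G (t p) | p <- enum 'I_n] [seq G p | p <- enum 'I_n].
Proof.
rewrite (map_comp G t); apply: perm_map; apply: uniq_perm.
- by rewrite (map_inj_uniq (@perm_inj _ t)) enum_uniq.
- exact: enum_uniq.
move=> p; rewrite mem_enum; apply/mapP.
by exists ((t^-1)%g p); rewrite ?mem_enum // permKV.
Qed.

(** * Determinants of size r + 1 *)

Section PositiveLevel.
Variables (d : nat) (r : C) (F : Fock d) (n : nat).
Local Notation V := (FV F).
Local Notation L := (Lab d).
Local Notation mB := (@mul d F).
Local Notation mv := (mv F).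
Local Notation opE := (opE F).
Local Notation opD := (opD r F).
Local Notation I := 'I_n.+1.
Implicit Types (a b : L) (u v : V) (c e : I -> L).

(** The index type is free because splitting off the row [ord0] of a minor leaves products indexed
    by ['I_n]. *)
Definition prodv (J : Type) (s : seq J) (x y : J -> L) : V :=
  mv [seq xk (x p) (y p) | p <- s].

Lemma prodv_cons (J : Type) (j : J) s (x y : J -> L) :
  prodv (j :: s) x y = mB (xk (x j) (y j)) (prodv s x y).
Proof. by rewrite /prodv /= mul_mv. Qed.

Lemma eq_prodv (J : eqType) (s : seq J) (x y x' y' : J -> L) :
  {in s, x =1 x'} -> {in s, y =1 y'} -> prodv s x y = prodv s x' y'.
Proof.
by move=> h1 h2; congr mv; apply/eq_in_map => p ps; rewrite h1 ?h2.
Qed.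

Lemma eq_prodv_xk (J : Type) (s : seq J) (x y x' y' : J -> L) :
  (forall p, xk (x p) (y p) = xk (x' p) (y' p)) -> prodv s x y = prodv s x' y'.
Proof. by move=> h; congr mv; apply: eq_map. Qed.

Lemma prodvC (J : Type) (s : seq J) (x y : J -> L) : prodv s x y = prodv s y x.
Proof. by congr mv; apply: eq_map => p; rewrite xkC. Qed.

Lemma opE_prodv (J : eqType) (s : seq J) (x y : J -> L) a b : uniq s ->
  opE a b (prodv s x y) =
  \sum_(k <- s) (dl a (x k) *: prodv s (fun p => if p == k then b else x p) y
               + dl a (y k) *: prodv s x (fun p => if p == k then b else y p)).
Proof.
elim: s => [|j s IH] /=; first by rewrite big_nil opE_vac.
case/andP => js us; rewrite prodv_cons opE_X IH // big_cons linear_sum /=.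
rewrite !prodv_cons !eqxx.
have nj p : p \in s -> (p == j) = false.
  by move=> ps; apply/negP => /eqP e; rewrite -e ps in js.
have -> : prodv s (fun p => if p == j then b else x p) y = prodv s x y.
  by apply: eq_prodv => // p ps; rewrite nj.
have -> : prodv s x (fun p => if p == j then b else y p) = prodv s x y.
  by apply: eq_prodv => // p ps; rewrite nj.
rewrite -addrA addrC; congr (_ + _).
apply: eq_big_seq => k ks; rewrite mBD !mBZ !prodv_cons.
by have -> : (j == k) = false by rewrite eq_sym nj.
Qed.

Lemma opE_notin (J : eqType) (s : seq J) (x y : J -> L) a b :
  {in s, forall p, (a != x p) && (a != y p)} -> opE a b (prodv s x y) = 0.
Proof.
elim: s => [|j s IH] h; first by rewrite opE_vac.
have /andP[ax ay] := h j (mem_head _ _).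
rewrite prodv_cons opE_X !dl_neq // !scale0r !addr0 IH ?linear0 // => p ps.
by apply: h; rewrite inE ps orbT.
Qed.

Lemma opD_notin (J : eqType) (s : seq J) (x y : J -> L) a b :
  {in s, forall p, (a != x p) && (a != y p)} -> opD a b (prodv s x y) = 0.
Proof.
elim: s => [|j s IH] h; first by rewrite opD_vac.
have /andP[ax ay] := h j (mem_head _ _).
have hs : {in s, forall p, (a != x p) && (a != y p)}.
  by move=> p ps; apply: h; rewrite inE ps orbT.
rewrite prodv_cons opD_X !(dl_neq ax) !(dl_neq ay) IH // linear0.
by rewrite !(opE_notin _ hs) !mul0r addr0 mulr0 !scale0r !scaler0 !addr0.
Qed.

Definition minor c e : V :=
  \sum_(s : 'S_n.+1) sgnp s *: prodv (enum I) c (e \o s).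

Lemma prodv_perm (t : 'S_n.+1) c e :
  prodv (enum I) (c \o t) (e \o t) = prodv (enum I) c e.
Proof.
by apply: mv_perm; apply: (perm_map_perm (fun p => xk (c p) (e p)) t).
Qed.

Lemma minor_perm (t : 'S_n.+1) c e : minor (c \o t) e = sgnp t *: minor c e.
Proof.
rewrite /minor scaler_sumr (reindex_inj (mulgI t)) /=.
apply: eq_bigr => s _; rewrite sgnpM -scalerA.
suff -> : prodv (enum I) (c \o t) (e \o (t * s)%g) = prodv (enum I) c (e \o s) by [].
rewrite -[RHS](prodv_perm t); apply: eq_prodv => p _ //.
by rewrite /= permM.
Qed.

Lemma minorC c e : minor c e = minor e c.
Proof.
rewrite /minor (reindex_inj invg_inj) /=; apply: eq_bigr => s _.
rewrite sgnpV.
suff -> : prodv (enum I) c (e \o s^-1%g) = prodv (enum I) e (c \o s) by [].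
rewrite -(prodv_perm s) prodvC; apply: eq_prodv => p _ //.
by rewrite /= permK.
Qed.

Lemma good_prodv (J : Type) (s : seq J) (x y : J -> L) : good (prodv s x y).
Proof. by apply: good_mv; elim: s => //= p s ->; rewrite inBminus_xk. Qed.

Section Independent.
Variables c e : I -> L.
Hypothesis c_inj : injective c.
Hypothesis ce_neq : forall p q, c p != e q.

(** The label [c ord0] occurs once in each product. The scalar term contributes r. Replacing one of
    the other n column labels gives the term of a permutation of opposite sign, hence -1 each.
    Replacing a row label joins two column labels in a symmetric factor, so these terms cancel in
    pairs. The total factor is r - n. *)
Lemma opD_minor_head b : r = n%:R -> opD (c ord0) b (minor c e) = 0.
Proof.
move=> rn; rewrite /minor linear_sum /=.
pose s' := enum 'I_n.
pose c' p := c (lift ord0 p).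
pose e' (s : 'S_n.+1) p := e (s (lift ord0 p)).
pose tau k : 'S_n.+1 := tperm ord0 (lift ord0 k).
pose T (s : 'S_n.+1) := dl b (e (s ord0)) *: prodv s' c' (e' s).
pose U (s : 'S_n.+1) (k : 'I_n) : V :=
  prodv s' (fun p => if p == k then e (s ord0) else c' p) (e' s).
have Dterm (s : 'S_n.+1) : opD (c ord0) b (prodv (enum I) c (e \o s)) =
    r *: T s + \sum_(k < n) (dl b (c' k) *: U s k + T (tau k * s)%g).
  have -> : prodv (enum I) c (e \o s) =
      mB (xk (c ord0) (e (s ord0))) (prodv s' c' (e' s)).
    by rewrite /prodv enum_ordSl /= -mul_mv -map_comp.
  have c0 : {in s', forall p, (c ord0 != c' p) && (c ord0 != e' s p)}.
    by move=> p _; rewrite ce_neq andbT (inj_eq c_inj).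
  rewrite opD_X opD_notin // linear0 add0r !(opE_notin _ c0) !scaler0 !addr0.
  rewrite dlxx !(dl_neq (ce_neq _ _)) !scale0r !addr0 mul1r mul0r addr0 scale1r.
  rewrite addrC /T scalerA; congr (_ + _).
  rewrite opE_prodv ?enum_uniq // big_enum; apply: eq_bigr => k _.
  congr (_ + _); rewrite permM tpermL; congr (_ *: _).
  apply: eq_prodv => // p _; rewrite /e' permM.
  case: (eqVneq p k) => [->|pk]; first by rewrite tpermR.
  by rewrite tpermD ?neq_lift // (inj_eq lift_inj) eq_sym.
(* [tau k] matches the terms in [T] and leaves those in [U] unchanged. *)
have tau_odd k (s : 'S_n.+1) : sgnp (tau k * s)%g = - sgnp s.
  by rewrite sgnpM sgnp_tperm ?neq_lift // mulN1r.
pose S1 := \sum_(s : 'S_n.+1) sgnp s *: T s.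
transitivity (r *: S1 + \sum_(k < n) (dl b (c' k) *:
    (\sum_(s : 'S_n.+1) sgnp s *: U s k) - S1)).
  under eq_bigr => s _ do
    rewrite linearZZ Dterm scalerDr scalerA mulrC -scalerA scaler_sumr.
  rewrite big_split -scaler_sumr exchange_big /=; congr (_ + _).
  apply: eq_bigr => k _.
  under eq_bigr => s _ do rewrite scalerDr scalerA mulrC -scalerA.
  rewrite big_split -scaler_sumr; congr (_ + _).
  rewrite /S1 (reindex_inj (mulgI (tau k))) -sumrN /=; apply: eq_bigr => s _.
  by rewrite tau_odd scaleNr mulgA tperm2 mul1g.
have U0 k : \sum_(s : 'S_n.+1) sgnp s *: U s k = 0.
  set Z := LHS; suff ZN : Z = - Z.
    have : 2%:R *: Z = 0 by rewrite scaler_nat mulr2n {1}ZN addNr.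
    by move=> /eqP; rewrite scaler_eq0 (negPf (natC_neq0 1)) => /eqP.
  rewrite {1}/Z (reindex_inj (mulgI (tau k))) -sumrN /=; apply: eq_bigr => s _.
  rewrite tau_odd scaleNr; suff -> : U (tau k * s)%g k = U s k by [].
  apply: eq_prodv_xk => p; rewrite /e' !permM tpermL.
  case: (eqVneq p k) => [->|pk]; first by rewrite tpermR xkC.
  by rewrite tpermD ?neq_lift // (inj_eq lift_inj) eq_sym.
under eq_bigr do rewrite U0 scaler0 add0r.
by rewrite sumr_const card_ord -scaler_nat rn scalerN subrr.
Qed.

End Independent.

Lemma opD_minor_left c e p b : injective c ->
  (forall p q, c p != e q) -> r = n%:R -> opD (c p) b (minor c e) = 0.
Proof.
move=> ci ce rn; pose t : 'S_n.+1 := tperm ord0 p.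
have -> : minor c e = sgnp t *: minor (c \o t) e.
  by rewrite minor_perm scalerA sgnp_sq scale1r.
rewrite opDZ.
have := @opD_minor_head (c \o t) e _ _ b rn; rewrite /= tpermL => -> //.
- by rewrite scaler0.
- by move=> x y /ci /perm_inj.
Qed.

Variables c e : I -> L.
Hypothesis c_inj : injective c.
Hypothesis e_inj : injective e.
Hypothesis ce_neq : forall p q, c p != e q.

Lemma opD_minor a b : r = n%:R -> opD a b (minor c e) = 0.
Proof.
move=> rn.
have [/existsP [p /eqP ->]|/existsPn ac] := boolP [exists p, a == c p].
  exact: opD_minor_left.
have [/existsP [p /eqP ->]|/existsPn ae] := boolP [exists p, a == e p].
  by rewrite minorC; apply: opD_minor_left => // x y; rewrite eq_sym.
rewrite /minor linear_sum big1 // => s _ /=; rewrite opDZ opD_notin ?scaler0 //.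
by move=> p _; rewrite ac ae.
Qed.

Lemma good_minor : good (minor c e).
Proof.
rewrite /minor; elim/big_ind: _ => [|u v|s _]; first exact: good0.
  exact: goodD.
by apply: goodZ; apply: good_prodv.
Qed.

Lemma minor_null : r = n%:R -> null r (minor c e).
Proof.
move=> rn; apply: singular_null => [a b|]; first exact: opD_minor.
rewrite /minor linear_sum big1 // => s _; rewrite coefZ /prodv enum_ordSl /=.
by rewrite -mul_mv eps_mul mulr0.
Qed.

(** Row and column labels are distinct and disjoint, so the entries are distinct generators and the
    diagonal monomial comes from the identity permutation alone. *)
Lemma minor_neq0 : minor c e != 0.
Proof.
pose m := mset_of_seq [seq xk (c p) (e p) | p <- enum I].
suff h : coef m (minor c e) = 1.
  by apply/eqP => v0; move/eqP: h; rewrite v0 coef0 eq_sym oner_eq0.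
rewrite /minor linear_sum (bigD1 1%g) //= sgnp1 scale1r coef_mv.
have -> : mset_of_seq [seq xk (c p) ((e \o (1%g : 'S_n.+1)) p) | p <- enum I] = m.
  by congr mset_of_seq; apply: eq_map => p; rewrite /= perm1.
rewrite eqxx big1 ?addr0 // => s s1; rewrite coefZ coef_mv.
case: eqP => [em|_]; last by rewrite mulr0.
case/eqP: s1; apply/permP => p; rewrite perm1.
have : (0 < m (xk (c p) (e (s p))))%N.
  rewrite -em mset_of_seqE -has_count has_pred1; apply/mapP.
  by exists p; rewrite ?mem_enum.
rewrite mset_of_seqE -has_count has_pred1 => /mapP [q _ /xk_inj [] [e1 e2]].
  by rewrite {2}(c_inj e1); apply: e_inj.
by have := ce_neq p q; rewrite e1 eqxx.
Qed.

End PositiveLevel.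

(** * The operators L^{ij}(m) *)

Section NormalForm.
Variable d : nat.
Local Notation key := (key d).
Local Notation L := (Lab d).

Definition swapk (k : key) : key := (k.1.1.2, k.1.1.1, k.2, k.1.2).

Lemma nrmE (k : key) : (nrm k).1 = k \/ (nrm k).1 = swapk k.
Proof.
case: k => [[[i j] m] n]; rewrite /nrm /swapk /=.
case: (ltngtP i j) => [_|_|/val_inj <-] /=; [by left|by right|].
by case: ifP => _; [left|right].
Qed.

Lemma nrm_const (k : key) : (nrm k).2 =
  if [&& k.1.1.1 == k.1.1.2, k.2 < k.1.2 & k.1.2 + k.2 == 0]
  then k.1.2%:~R else 0.
Proof.
case: k => [[[i j] m] n]; rewrite /nrm /= -val_eqE /=.
case: (ltngtP i j) => [_|_|_] //=; rewrite ltNge.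
by case: (m <= n) => //=; case: ifP.
Qed.

Lemma inBminus_nrm (k : key) : inBminus (nrm k).1 = (k.1.2 < 0) && (k.2 < 0).
Proof.
case: k => [[[i j] m] n]; rewrite /nrm /=.
case: (ltngtP i j) => [lij|lji|/val_inj <-] /=.
- by rewrite lij.
- by rewrite lji /= andbC.
by case: (lerP m n) => [le|/ltW le]; rewrite /= eqxx le orbT //= andbC.
Qed.

End NormalForm.

(** * The action in terms of creation, replacement and annihilation *)

Section Action.
Variables (d : nat) (r : C) (F : Fock d).
Local Notation V := (FV F).
Local Notation key := (key d).
Local Notation L := (Lab d).
Local Notation vc := (@mv d F [::]).
Local Notation mB := (@mul d F).
Local Notation mv := (mv F).
Local Notation opE := (opE F).
Local Notation opD := (opD r F).
Implicit Types (a : L) (b c k : key) (u v : V) (w : seq key).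

(* [aw], [awRaw] and [awL] repeat [actw], [actRaw] and [LopW] for an arbitrary
   [Fock]; on [VecFock d] they are convertible to them. *)
Fixpoint aw (b : key) (w : seq key) {struct w} : V :=
  if inBminus b then mv (b :: w) else
  match w with
  | [::] => 0
  | c :: w' =>
      mB c (aw b w')
      + \sum_(t <- brB b c)
          t.1 *: (if inBminus t.2 then mv (t.2 :: w') else aw t.2 w')
      + brC r b c *: mv w'
  end.

Definition awRaw (k : key) (w : seq key) : V :=
  aw (nrm k).1 w + (nrm k).2 *: mv w.

Definition awL (i j : 'I_d) (m : int) (w : seq key) : V :=
  let K := bnd m w in
  if (i == j) && (m == 0) then
    2^-1 *: awRaw (i, i, 0, 0) w
    + \sum_(1 <= h < K.+1) awRaw (i, i, - (h%:Z), h%:Z) w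
  else
    2^-1 *: \sum_(0 <= t < (K + K).+1)
               awRaw (i, j, m - (t%:Z - K%:Z), t%:Z - K%:Z) w.

Definition opL i j m : {linear V -> V} := ext (awL i j m).

(* The normally ordered v^{ij}(m,n), as an operator. *)
Definition opA (k : key) v : V :=
  let: (i, j, m, n) := k in
  match m, n with
  | Negz p, Negz q => mB (xk (i, p) (j, q)) v
  | Posz p.+1, Negz q => p.+1%:R *: opE (i, p) (j, q) v
  | Negz p, Posz q.+1 => q.+1%:R *: opE (j, q) (i, p) v
  | Posz p.+1, Posz q.+1 => (p.+1%:R * q.+1%:R) *: opD (i, p) (j, q) v
  (* An element with a zero mode kills the vacuum, and its brackets with B_- involve only such
     elements again. *)
  | _, _ => 0
  end.

Lemma opA_lin k x u v : opA k (x *: u + v) = x *: opA k u + opA k v.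
Proof.
case: k => [[[i j] [[|p]|p]] [[|q]|q]] /=; rewrite ?scaler0 ?addr0 //.
- by rewrite opDD opDZ; vring.
- by rewrite opED opEZ; vring.
- by rewrite opED opEZ; vring.
- by rewrite mBD mBZ; vring.
Qed.
HB.instance Definition _ k :=
  GRing.isLinear.Build C V V *:%R (opA k) (opA_lin k).

Lemma opA_swap k v : opA (swapk k) v = opA k v.
Proof.
case: k => [[[i j] [[|p]|p]] [[|q]|q]] //=; first by rewrite opD_sym mulrC.
by rewrite xkC.
Qed.

#[local] Arguments opA : simpl never.

Lemma aw_minus b w : inBminus b -> aw b w = mv (b :: w).
Proof. by case: w => [|c w] /= ->. Qed.

Lemma good_opA k v : good v -> good (opA k v).
Proof.
case: k => [[[i j] [[|p]|p]] [[|q]|q]] gv; try exact: good0.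
- exact/goodZ/good_opD.
- exact/goodZ/good_opE.
- exact/goodZ/good_opE.
- exact: good_X.
Qed.

Definition brS (k c : key) v : V :=
  let: (i, j, m, n) := k in let: (s, l, p, q) := c in
  hbr j s n p *: opA (i, l, m, q) v + hbr j l n q *: opA (i, s, m, p) v
  + hbr i s m p *: opA (l, j, q, n) v + hbr i l m q *: opA (s, j, p, n) v
  + (r * (hbr j s n p * hbr i l m q + hbr j l n q * hbr i s m p)) *: v.

Lemma brS_swap k c v : brS (swapk k) c v = brS k c v.
Proof.
case: k c => [[[i j] m] n] [[[s l] p] q]; rewrite /brS /swapk /=.
rewrite -(opA_swap (i, l, m, q)) -(opA_swap (i, s, m, p)).
by rewrite -(opA_swap (l, j, q, n)) -(opA_swap (s, j, p, n)) /swapk /=; vring.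
Qed.

(** Only the first two terms of [brA k c] can yield a constant: the other two begin with a negative
    mode, so that v^{lj}(q,n) with n = -q is already in normal order. *)
Lemma brC_hbr k c : inBminus c ->
  brC r k c = r * (hbr k.1.1.2 c.1.1.1 k.2 c.1.2 * hbr k.1.1.1 c.1.1.2 k.1.2 c.2
              + hbr k.1.1.2 c.1.1.2 k.2 c.2 * hbr k.1.1.1 c.1.1.1 k.1.2 c.1.2).
Proof.
case: k c => [[[i j] m] n] [[[s l] p] q] /= /andP[/andP[_ p0] q0].
rewrite /brC /brA !big_cons big_nil !nrm_const /=; congr (_ * _).
have h1 (x : 'I_d) (y : int) : y < 0 ->
    (if [&& i == x, y < m & m + y == 0] then (m%:~R : C) else 0) = hbr i x m y.
  move=> y0; rewrite /hbr; case: (i == x) => //=; case: eqP => // my.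
    by have -> : y < m by lia.
  by rewrite andbF.
have h3 (x : 'I_d) (y z : int) : y < 0 -> z < 0 ->
  hbr i x m z * (if [&& l == j, n < y & y + n == 0] then (y%:~R : C) else 0) = 0.
  by move=> y0 z0; case: ifP; rewrite ?mulr0 // => /and3P[_ ? /eqP ?]; lia.
rewrite !h1 //.
have -> : [&& l == j, n < q & q + n == 0] = false.
  by apply/negP => /and3P[_ ? /eqP ?]; lia.
have -> : [&& s == j, n < p & p + n == 0] = false.
  by apply/negP => /and3P[_ ? /eqP ?]; lia.
by rewrite !mulr0 !addr0.
Qed.

Lemma opA_mB k c v : inBminus c -> ~~ ((k.1.2 < 0) && (k.2 < 0)) ->
  opA k (mB c v) = mB c (opA k v) + brS k c v.
Proof.
case: k c => [[[i j] m] n] [[[s l] [p|p]] [q|q]] //=; rewrite ?andbF //.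
set c := (s, l, Negz p, Negz q) => gc kn.
have l1 : lab1 c = (s, p) by [].
have l2 : lab2 c = (l, q) by [].
have hP (x y : 'I_d) (t z : nat) :
    hbr x y (Posz t.+1) (Negz z) = t.+1%:R * dl (x, t) (y, z) :> C.
  rewrite /hbr /dl xpair_eqE; case: (x == y) => /=; last by rewrite mulr0.
  have -> : (Posz t.+1 + Negz z == 0) = (t == z) by lia.
  by case: (t == z); rewrite ?mulr1 ?mulr0.
have h0 (x y : 'I_d) (z : nat) : hbr x y 0 (Negz z) = 0 :> C.
  by rewrite /hbr; case: ifP.
have hN (x y : 'I_d) (t z : nat) : hbr x y (Negz t) (Negz z) = 0 :> C.
  by rewrite /hbr; case: ifP => // /andP[_ /eqP]; lia.
case: m n kn => [[|m]|m] [[|n]|n] // _; rewrite /opA /= ?(h0, hN, hP).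
- by rewrite linear0; vring.
- by rewrite linear0; vring.
- by rewrite linear0; vring.
- by rewrite linear0; vring.
- by rewrite opD_mB l1 l2 mBZ; vring.
- by rewrite opE_mB l1 l2 mBZ !(xkC (j, n)); vring.
- by rewrite linear0; vring.
- by rewrite opE_mB l1 l2 mBZ !(xkC (i, m)); vring.
Qed.

(** By [opA_mB], [opA] obeys the recursion that defines the action; [brC_hbr] matches the scalar
    parts. *)
Lemma aw_opA k w : all (@inBminus d) w -> aw (nrm k).1 w = opA k (mv w).
Proof.
elim: w k => [|c w IH] k gw.
  case: (boolP ((k.1.2 < 0) && (k.2 < 0))) => kn.
    rewrite aw_minus ?inBminus_nrm // -mul_mv.
    by case: k kn => [[[i j] [m|m]] [n|n]] //=; rewrite andbF.
  rewrite /= inBminus_nrm (negPf kn).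
  case: k kn => [[[i j] [[|m]|m]] [[|n]|n]] //= _;
    by rewrite /opA /= ?opE_vac ?opD_vac ?scaler0.
have /andP[gc gw'] := gw.
case: (boolP ((k.1.2 < 0) && (k.2 < 0))) => kn.
  rewrite aw_minus ?inBminus_nrm // -mul_mv.
  by case: k kn => [[[i j] [m|m]] [n|n]] //=; rewrite andbF.
rewrite /= inBminus_nrm (negPf kn) IH // -mul_mv opA_mB //.
rewrite -addrA; congr (_ + _).
have sumE : \sum_(t <- brB (nrm k).1 c) t.1 *:
    (if inBminus t.2 then mv (t.2 :: w) else aw t.2 w) =
    \sum_(t <- brA (nrm k).1 c) t.1 *: opA t.2 (mv w).
  rewrite /brB big_map; apply: eq_bigr => t _ /=.
  by case: ifP => [gt|_]; rewrite -IH // aw_minus.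
rewrite sumE brC_hbr //.
have key0 b : \sum_(t <- brA b c) t.1 *: opA t.2 (mv w) +
  (r * (hbr b.1.1.2 c.1.1.1 b.2 c.1.2 * hbr b.1.1.1 c.1.1.2 b.1.2 c.2
   + hbr b.1.1.2 c.1.1.2 b.2 c.2 * hbr b.1.1.1 c.1.1.1 b.1.2 c.1.2)) *: mv w
  = brS b c (mv w).
  case: b c {sumE gw gc} => [[[i j] m] n] [[[s l] p] q].
  by rewrite /brS /brA !big_cons big_nil /=; vring.
by rewrite key0; case: (nrmE k) => ->; rewrite ?brS_swap.
Qed.

(** The condition excludes v^{ii}(m,-m), m > 0, the only case where reordering leaves a constant. *)
Lemma awRaw_opA i j m n w : all (@inBminus d) w ->
  (i != j) || (m + n != 0) || (m <= n) ->
  awRaw (i, j, m, n) w = opA (i, j, m, n) (mv w).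
Proof.
move=> gw h; rewrite /awRaw aw_opA // nrm_const /=.
case: ifP => [/and3P[/eqP e lt /eqP s0]|_]; last by rewrite scale0r addr0.
by move: h; rewrite e eqxx s0 leNgt lt.
Qed.

Lemma op_fresh a (b : L) w : {in w, forall k, (a != lab1 k) && (a != lab2 k)} ->
  opE a b (mv w) = 0 /\ opD a b (mv w) = 0.
Proof.
elim: w => [|k w IH] h; first by rewrite opE_vac opD_vac.
have /andP[a1 a2] := h k (mem_head _ _).
have hw : {in w, forall k, (a != lab1 k) && (a != lab2 k)}.
  by move=> x xw; apply: h; rewrite inE xw orbT.
have [E0 D0] := IH hw.
have {}E0 (x : L) : opE a x (mv w) = 0.
  elim: w {IH h D0 E0} hw => [|l w IH] h; first by rewrite opE_vac.
  have /andP[l1 l2] := h l (mem_head _ _).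
  rewrite -mul_mv opE_mB !dl_neq // !scale0r !addr0 IH ?linear0 // => y yw.
  by apply: h; rewrite inE yw orbT.
rewrite -mul_mv opE_mB opD_mB !E0 D0 !(dl_neq a1) !(dl_neq a2) !mul0r addr0.
by rewrite mulr0 !scale0r !scaler0 linear0 !addr0.
Qed.

Definition wsum w : nat := (\sum_(k <- w) (`|k.1.2| + `|k.2|))%N.

Lemma wsum_fresh w i p : all (@inBminus d) w -> (wsum w <= p)%N ->
  {in w, forall k, ((i, p) != lab1 k :> L) && ((i, p) != lab2 k)}.
Proof.
move=> /allP gw le k kw; have := gw k kw.
have : (`|k.1.2| + `|k.2| <= p)%N.
  by apply: leq_trans le; rewrite /wsum (big_rem k) //= leq_addr.
case: k {kw} => [[[s l] m] n] /= le' /andP[/andP[_ m0] n0].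
by rewrite /lab1 /lab2 /= !xpair_eqE; apply/andP; split;
  apply/negP => /andP[_ /eqP]; lia.
Qed.

Lemma opA_far i j m n w : all (@inBminus d) w ->
  (Posz (wsum w) < m) || (Posz (wsum w) < n) -> opA (i, j, m, n) (mv w) = 0.
Proof.
move=> gw; case: m n => [[|m]|m] [[|n]|n] h //; rewrite /opA.
- case: (leqP (wsum w) m) => hm.
    by have [_ ->] := op_fresh (j, n) (wsum_fresh i gw hm); rewrite scaler0.
  have hn : (wsum w <= n)%N by lia.
  by rewrite opD_sym; have [_ ->] := op_fresh (i, m) (wsum_fresh j gw hn); rewrite scaler0.
- have hm : (wsum w <= m)%N by lia.
  by have [-> _] := op_fresh (j, n) (wsum_fresh i gw hm); rewrite scaler0.
- have hn : (wsum w <= n)%N by lia.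
  by have [-> _] := op_fresh (i, m) (wsum_fresh j gw hn); rewrite scaler0.
Qed.

(** The cutoff in [awL] varies with the word; a common one makes the truncated sum linear in v. The
    summand v^{ii}(0,0) is left out, since it acts as 0. *)
Definition sumA i j m (N : nat) v : V :=
  if (i == j) && (m == 0) then
    \sum_(1 <= h < N.+1) opA (i, i, - (h%:Z), h%:Z) v
  else 2^-1 *: \sum_(0 <= t < (N + N).+1)
               opA (i, j, m - (t%:Z - N%:Z), t%:Z - N%:Z) v.

Lemma sumA_lin i j m N x u v :
  sumA i j m N (x *: u + v) = x *: sumA i j m N u + sumA i j m N v.
Proof.
rewrite /sumA; case: ifP => _.
  rewrite scaler_sumr -big_split; apply: eq_bigr => h _; exact: opA_lin.
rewrite (eq_bigr _ (fun t _ => opA_lin _ x u v)) big_split -scaler_sumr /=.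
by vring.
Qed.

Lemma sum_window (f : int -> V) (K N : nat) : (K <= N)%N ->
  (forall h, Posz K < `|h| -> f h = 0) ->
  \sum_(0 <= t < (N + N).+1) f (t%:Z - N%:Z) =
  \sum_(0 <= t < (K + K).+1) f (t%:Z - K%:Z).
Proof.
move=> /subnKC <-; elim: (N - K)%N => [|n IH] f0; first by rewrite addn0.
rewrite addnS -IH // addSn addnS big_nat_recl // big_nat_recr //=.
rewrite f0 ?add0r; last by lia.
rewrite f0 ?addr0; last by lia.
by apply: eq_bigr => t _; congr f; lia.
Qed.

Lemma bndE m w : bnd m w = (`|m| + wsum w + 1)%N. Proof. by []. Qed.

Lemma awL_sumA i j m w N : all (@inBminus d) w -> (bnd m w <= N)%N ->
  awL i j m w = sumA i j m N (mv w).
Proof.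
move=> gw; rewrite /awL bndE /sumA => le; case: ifP => [_|ij].
  rewrite (awRaw_opA gw) ?lexx ?orbT //= scaler0 add0r.
  rewrite [RHS](big_cat_nat (n := (`|m| + wsum w + 1).+1)) //=.
  have -> : \sum_((`|m| + wsum w + 1).+1 <= h < N.+1)
      opA (i, i, - h%:Z, h%:Z) (mv w) = 0.
    rewrite big_nat big1 // => h /andP[h1 h2].
    by apply: opA_far => //; apply/orP; right; lia.
  rewrite addr0; apply: eq_bigr => h _; rewrite (awRaw_opA gw) //.
  by apply/orP; right; lia.
rewrite (sum_window (f := fun h => opA (i, j, m - h, h) (mv w)) le).
  congr (_ *: _); apply: eq_bigr => t _; apply: awRaw_opA => //.
  by rewrite subrK; move: ij; case: (i == j) => //= ->.
by move=> h hh; apply: opA_far => //; apply/orP; lia.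
Qed.

Lemma bnd_perm m (w w' : seq key) : perm_eq w w' -> bnd m w = bnd m w'.
Proof. by move=> ww'; rewrite /bnd (perm_big _ ww'). Qed.

Lemma opL_mv i j m w : all (@inBminus d) w -> opL i j m (mv w) = awL i j m w.
Proof.
move=> gw; rewrite /opL ext_enum.
have pw := perm_mset_of_seq w.
have gw' : all (@inBminus d) (enum_mset (mset_of_seq w)).
  by rewrite (perm_all _ pw).
rewrite (awL_sumA _ _ gw' (leqnn _)) (mv_perm pw) -awL_sumA //.
by rewrite (bnd_perm _ pw).
Qed.

Lemma opL_sumA i j m v : good v ->
  exists N0, forall N, (N0 <= N)%N -> opL i j m v = sumA i j m N v.
Proof.
apply: (Fock_ind_supp (@inBminus d) (fun v => exists N0, forall N,
  (N0 <= N)%N -> opL i j m v = sumA i j m N v)) => [|x u1 u2 [N1 h1] [N2 h2]|w gw].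
- exists 0%N => N _; rewrite linear0; apply/esym.
  by rewrite -[0](scale0r (0 : V)) -[X in sumA _ _ _ _ X]addr0 sumA_lin scale0r
    add0r; rewrite /sumA; case: ifP => _; rewrite big1 ?scaler0 ?addr0 // => h _;
    exact: linear0.
- exists (maxn N1 N2) => N; rewrite geq_max => /andP[le1 le2].
  by rewrite linearP sumA_lin (h1 _ le1) (h2 _ le2).
- by exists (bnd m w) => N le; rewrite opL_mv // (awL_sumA _ _ gw le).
Qed.

Lemma good_sumA i j m N v : good v -> good (sumA i j m N v).
Proof.
move=> gv; rewrite /sumA; case: ifP => _; last apply: goodZ;
  by elim/big_ind: _ => [|u1 u2|h _]; [exact: good0|exact: goodD|exact: good_opA].
Qed.

Lemma good_opL i j m v : good v -> good (opL i j m v).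
Proof.
by move=> gv; have [N0 h] := opL_sumA i j m gv; rewrite (h N0) //; apply: good_sumA.
Qed.

Lemma null_opA k v : null r v -> null r (opA k v).
Proof.
case: k => [[[i j] [[|p]|p]] [[|q]|q]] nv; try exact: null0.
- exact/nullZ/null_opD.
- exact/nullZ/null_opE.
- exact/nullZ/null_opE.
- exact: null_X.
Qed.

Lemma null_opL i j m v : good v -> null r v -> null r (opL i j m v).
Proof.
move=> gv nv; have [N0 h] := opL_sumA i j m gv; rewrite (h N0) // /sumA.
case: ifP => _; last apply: nullZ;
  by elim/big_ind: _ => [|u1 u2|k _]; [exact: null0|exact: nullD|exact: null_opA].
Qed.

End Action.
Arguments opA : simpl never.

(** * The gradings by L^{jj}(0) *)

Section Weights.
Variables (d : nat) (r : C) (F : Fock d) (j : 'I_d).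
Local Notation V := (FV F).
Local Notation key := (key d).
Local Notation L := (Lab d).
Local Notation vc := (@mv d F [::]).
Local Notation mB := (@mul d F).
Local Notation mv := (mv F).
Local Notation opE := (opE F).
Local Notation opD := (opD r F).
Implicit Types (a b : L) (k : key) (u v : V) (w : seq key).

Definition wtl a : nat := if a.1 == j then a.2.+1 else 0%N.
Definition wtk k : nat := (wtl (lab1 k) + wtl (lab2 k))%N.
Definition wt w : nat := (\sum_(k <- w) wtk k)%N.

Definition opH : {linear V -> V} := ext (fun w => (wt w)%:R *: mv w).

Lemma opHD u v : opH (u + v) = opH u + opH v. Proof. exact: linearD. Qed.
Lemma opHZ x v : opH (x *: v) = x *: opH v. Proof. exact: linearZZ. Qed.

Lemma opH_mv w : opH (mv w) = (wt w)%:R *: mv w.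
Proof.
apply: ext_mv => w1 w2 h.
by rewrite (mv_perm h) /wt (perm_big _ h).
Qed.

Lemma opH_mB k v : opH (mB k v) = mB k (opH v) + (wtk k)%:R *: mB k v.
Proof.
elim/Fock_mono_ind: v => [|x u v IHu IHv|w].
- by rewrite !linear0 ?scaler0 ?addr0.
- by rewrite !(mBD, mBZ, opHD, opHZ) IHu IHv; vring.
- by rewrite mul_mv !opH_mv mBZ mul_mv /wt big_cons natrD scalerDl addrC.
Qed.

Lemma opH_X a b v : opH (mB (xk a b) v) =
  mB (xk a b) (opH v) + ((wtl a)%:R + (wtl b)%:R) *: mB (xk a b) v.
Proof.
by rewrite opH_mB /wtk natrD; case: (lab_xk a b) => -[-> ->] //; rewrite addrC
  [_ + _%:R]addrC addrC.
Qed.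

Let linE := (mBD, mBZ, mBN, opED, opEZ, opDD, opDZ, opHD, opHZ).

Lemma opH_opE a b v : opH (opE a b v) =
  opE a b (opH v) + ((wtl b)%:R - (wtl a)%:R) *: opE a b v.
Proof.
elim/Fock_ind: v => [|x u v IHu IHv||k v IH].
- by rewrite !linear0 ?scaler0 ?addr0.
- by rewrite !linE IHu IHv; vring.
- by rewrite opH_mv opEZ opE_vac linear0 !scaler0 addr0.
- rewrite !(opH_X, opH_mB, linE, opE_mB) IH !linE /wtk natrD.
  rewrite /dl; case: (a =P lab1 k) => [<-|_]; case: (a =P lab2 k) => [<-|_];
    by rewrite /=; vring.
Qed.

Lemma opH_opD a b v : opH (opD a b v) =
  opD a b (opH v) - ((wtl a)%:R + (wtl b)%:R) *: opD a b v.
Proof.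
elim/Fock_ind: v => [|x u v IHu IHv||k v IH].
- by rewrite !linear0 ?scaler0 ?subr0 ?addr0.
- by rewrite !linE IHu IHv; vring.
- by rewrite opH_mv opDZ opD_vac linear0 !scaler0 subr0.
- rewrite !(opH_mB, linE, opD_mB) !opH_opE IH !linE /wtk natrD.
  have h1 (x : L) : dl a x * (wtl x)%:R = dl a x * (wtl a)%:R.
    by rewrite /dl; case: (a =P x) => [<-|] //; rewrite !mul0r.
  have h2 (x : L) : dl b x * (wtl x)%:R = dl b x * (wtl b)%:R.
    by rewrite /dl; case: (b =P x) => [<-|] //; rewrite !mul0r.
  apply: coef_inj => m; rewrite !(coefD, coefN, coefZ).
  have a1 := h1 (lab1 k); have a2 := h1 (lab2 k).
  have b1 := h2 (lab1 k); have b2 := h2 (lab2 k).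
  move: (dl a (lab1 k)) (dl a (lab2 k)) (dl b (lab1 k)) (dl b (lab2 k))
    ((wtl (lab1 k))%:R : C) ((wtl (lab2 k))%:R : C) ((wtl a)%:R : C)
    ((wtl b)%:R : C) a1 a2 b1 b2.
  move=> xa1 xa2 xb1 xb2 w1 w2 wa wb a1 a2 b1 b2.
  apply/eqP; rewrite -subr_eq0.
  (* The difference of the two sides, written as a combination of [a1], [a2], [b1], [b2]. *)
  rewrite [X in X == 0](_ : _ =
     - (xa1 * w1 - xa1 * wa) * coef m (opE b (lab2 k) v)
     - (xa2 * w2 - xa2 * wa) * coef m (opE b (lab1 k) v)
     - (xb1 * w1 - xb1 * wb) * coef m (opE a (lab2 k) v)
     - (xb2 * w2 - xb2 * wb) * coef m (opE a (lab1 k) v)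
     - r * ((xa1 * w1 - xa1 * wa) * xb2 + (xb2 * w2 - xb2 * wb) * xa1
          + (xa2 * w2 - xa2 * wa) * xb1 + (xb1 * w1 - xb1 * wb) * xa2)
       * coef m v).
    by rewrite a1 a2 b1 b2 !subrr !mul0r !addr0 mulr0 mul0r !oppr0 !mul0r !addr0.
  by ring.
Qed.

Lemma opH_opA i m n (z : C) v : i != j -> opH v = z *: v ->
  opH (opA r (i, j, m, n) v) = (z - n%:~R) *: opA r (i, j, m, n) v.
Proof.
move=> ij Hv.
have wi p : wtl (i, p) = 0%N by rewrite /wtl /= (negPf ij).
have wj p : wtl (j, p) = p.+1 by rewrite /wtl eqxx.
case: m n => [[|m]|m] [[|n]|n]; rewrite /opA ?linear0 ?scaler0 //.
- by rewrite opHZ opH_opD Hv opDZ wi wj -[(Posz n.+1)%:~R]/(n.+1%:R); vring.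
- by rewrite opHZ opH_opE Hv opEZ wi wj NegzE intrN -[(Posz n.+1)%:~R]/(n.+1%:R);
    vring.
- by rewrite opHZ opH_opE Hv opEZ wi wj -[(Posz n.+1)%:~R]/(n.+1%:R); vring.
- by rewrite opH_X Hv mBZ wi wj NegzE intrN -[(Posz n.+1)%:~R]/(n.+1%:R); vring.
Qed.

Lemma opE_diag a w : all (@inBminus d) w -> opE a a (mv w) =
  (\sum_(k <- w) (dl a (lab1 k) + dl a (lab2 k))) *: mv w.
Proof.
elim: w => [|k w IH] /=; first by rewrite big_nil opE_vac scale0r.
case/andP=> gk gw; rewrite -mul_mv opE_mB IH // big_cons mBZ.
have -> : dl a (lab1 k) *: mB (xk a (lab2 k)) (mv w) = dl a (lab1 k) *: mB k (mv w).
  rewrite /dl; case: (a =P lab1 k) => [->|_]; last by rewrite !scale0r.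
  by rewrite xk_lab.
have -> : dl a (lab2 k) *: mB (xk (lab1 k) a) (mv w) = dl a (lab2 k) *: mB k (mv w).
  rewrite /dl; case: (a =P lab2 k) => [->|_]; last by rewrite !scale0r.
  by rewrite xk_lab.
by vring.
Qed.

Lemma sum_dl a (N : nat) : (a.2 < N)%N ->
  \sum_(0 <= h < N) h.+1%:R * dl (j, h) a = (wtl a)%:R.
Proof.
move=> aN; rewrite /wtl; case: a aN => i p /= pN.
case: (eqVneq i j) => [->|ij].
  rewrite (bigD1_seq p) ?mem_index_iota ?iota_uniq //= dlxx mulr1 big1 ?addr0 //.
  by move=> h hp; rewrite dl_neq ?mulr0 // xpair_eqE negb_and hp orbT.
rewrite big1 // => h _; rewrite dl_neq ?mulr0 // xpair_eqE negb_and eq_sym ij //.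
Qed.

(** L^{jj}(0) is the sum over h of h + 1 times the replacement of (j,h) by itself, which counts the
    occurrences of that label. *)
Lemma opL_opH v : good v -> opL r F j j 0 v = opH v.
Proof.
move=> gv.
apply: (Fock_ind_supp (@inBminus d) (fun v => opL r F j j 0 v = opH v)) gv.
- by rewrite !linear0.
- by move=> x u1 u2 h1 h2; rewrite !linearP h1 h2.
move=> w gw; rewrite opL_mv // (awL_sumA _ _ _ _ gw (leqnn _)) opH_mv.
set N := bnd 0 w; rewrite /sumA !eqxx /= big_add1 /=.
have NE k : k \in w -> ((lab1 k).2 < N)%N && ((lab2 k).2 < N)%N.
  move=> kw; rewrite /N bndE /lab1 /lab2 /=.
  have : (`|k.1.2| + `|k.2| <= wsum w)%N.
    by rewrite /wsum (big_rem k) //= leq_addr.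
  by lia.
transitivity (\sum_(0 <= h < N)
    (\sum_(k <- w) h.+1%:R * (dl (j, h) (lab1 k) + dl (j, h) (lab2 k))) *: mv w).
  apply: eq_bigr => h _; rewrite -NegzE /opA opE_diag // scalerA.
  by rewrite mulr_sumr.
rewrite -scaler_suml exchange_big /wt natr_sum; congr (_ *: _).
apply: eq_big_seq => k kw; have /andP[k1 k2] := NE k kw.
rewrite /wtk natrD -(sum_dl k1) -(sum_dl k2) -big_split.
by apply: eq_bigr => h _; rewrite mulrDr.
Qed.

Lemma weight_decomposition v : exists (M : nat) (u : nat -> V),
  (forall N, opH (u N) = N%:R *: u N) /\ v = \sum_(N <- iota 0 M) u N.
Proof.
elim/Fock_mono_ind: v => [|x v1 v2 [M1 [u1 [h1 e1]]] [M2 [u2 [h2 e2]]]|w].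
- by exists 0%N, (fun=> 0); split=> [N|]; rewrite ?big_nil // linear0 scaler0.
(* The [u N] with N >= M are no part of the vector; they are cut off before two decompositions are
   added. *)
- pose t M (u : nat -> V) N := if (N < M)%N then u N else 0.
  have tE M (u : nat -> V) v : v = \sum_(N <- iota 0 M) u N -> forall M', (M <= M')%N ->
      v = \sum_(N <- iota 0 M') t M u N.
    move=> -> M' le; rewrite -(subnKC le) iotaD big_cat /=.
    have -> : \sum_(N <- iota M (M' - M)) t M u N = 0.
      rewrite big_seq big1 // => N; rewrite mem_iota /t => /andP[le' _].
      by rewrite ltnNge le'.
    rewrite addr0; apply: eq_big_seq => N; rewrite mem_iota /t => /andP[_].
    by rewrite add0n => ->.
  have tH M (u : nat -> V) : (forall N, opH (u N) = N%:R *: u N) ->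
      forall N, opH (t M u N) = N%:R *: t M u N.
    by move=> h N; rewrite /t; case: ifP => // _; rewrite linear0 scaler0.
  exists (maxn M1 M2), (fun N => x *: t M1 u1 N + t M2 u2 N); split.
    by move=> N; rewrite opHD opHZ !tH //; vring.
  rewrite big_split -scaler_sumr -(tE _ _ _ e1) ?leq_maxl //.
  by rewrite -(tE _ _ _ e2) ?leq_maxr.
- exists (wt w).+1, (fun N => if N == wt w then mv w else 0); split.
    by move=> N; case: eqP => [->|_]; rewrite ?opH_mv // linear0 scaler0.
  rewrite (bigD1_seq (wt w)) ?iota_uniq ?mem_iota //= eqxx big1 ?addr0 //.
  by move=> N /negPf ->.
Qed.

End Weights.

(** * Subspaces closed under all L^{ij}(m) *)

Section Closure.
Variables (d : nat) (r : C) (F : Fock d).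
Local Notation V := (FV F).
Local Notation key := (key d).
Local Notation L := (Lab d).
Local Notation vc := (@mv d F [::]).
Local Notation mB := (@mul d F).
Local Notation mv := (mv F).
Local Notation opE := (opE F).
Local Notation opD := (opD r F).
Implicit Types (a b c : L) (k : key) (u v : V) (w : seq key).

Variable K : V -> Prop.
Hypothesis K0 : K 0.
Hypothesis K_lin : forall (x : C) u v, K u -> K v -> K (x *: u + v).

Lemma K_add u v : K u -> K v -> K (u + v).
Proof. by rewrite -{2}[u]scale1r; apply: K_lin. Qed.
Lemma K_scale x v : K v -> K (x *: v).
Proof. by move=> kv; rewrite -[_ *: _]addr0; apply: K_lin. Qed.
Lemma K_sub u v : K u -> K v -> K (u - v).
Proof. by move=> ku kv; rewrite addrC -scaleN1r; apply: K_lin. Qed.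
Lemma K_sum (I : eqType) (s : seq I) (u : I -> V) :
  {in s, forall i, K (u i)} -> K (\sum_(i <- s) u i).
Proof.
by move=> h; rewrite big_seq; elim/big_ind: _ => // u1 u2; apply: K_add.
Qed.
Lemma K_unscale x v : x != 0 -> K (x *: v) -> K v.
Proof. by move=> x0 /(K_scale x^-1); rewrite scalerA mulVf // scale1r. Qed.

(** Applying [H - lam a] removes the component a and rescales the others by nonzero factors;
    induction on the number of components does the rest. *)
Lemma eigen_split (H : {linear V -> V}) (I : eqType) (s : seq I)
    (lam : I -> C) (u : I -> V) :
  (forall v, K v -> K (H v)) -> uniq s -> {in s &, injective lam} ->
  (forall i, H (u i) = lam i *: u i) -> K (\sum_(i <- s) u i) ->
  {in s, forall i, K (u i)}.
Proof.
move=> KH; elim: s u => [|a s IH] u //= /andP[as_ us] linj Hu Ks.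
have Kus : {in s, forall i, K (u i)}.
  have nz i : i \in s -> lam i - lam a != 0.
    move=> si; rewrite subr_eq0; apply/negP => /eqP /linj e.
    have ia : i = a by apply: e; rewrite inE ?eqxx ?si ?orbT.
    by rewrite -ia si in as_.
  move=> i si; apply: (K_unscale (nz i si)).
  move: i si; apply: (IH (fun i => (lam i - lam a) *: u i)) => //.
  - by move=> x y sx sy; apply: linj; rewrite inE ?sx ?sy orbT.
  - by move=> i; rewrite linearZZ Hu !scalerA mulrC.
  have -> : \sum_(i <- s) (lam i - lam a) *: u i =
      H (\sum_(i <- a :: s) u i) - lam a *: (\sum_(i <- a :: s) u i).
    rewrite !big_cons linearD scalerDr Hu linear_sum scaler_sumr /=.
    rewrite opprD addrACA subrr add0r -sumrB.
    by apply: eq_bigr => i _; rewrite Hu scalerBl.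
  by apply: K_sub; [apply: KH|apply: K_scale].
move=> i; rewrite inE => /orP[/eqP ->|]; last exact: Kus.
move: Ks; rewrite big_cons => Ks.
have -> : u a = (u a + \sum_(i <- s) u i) - \sum_(i <- s) u i by rewrite addrK.
by apply: K_sub => //; apply: K_sum.
Qed.

Hypothesis K_good : forall v, K v -> good v.
Hypothesis K_opL : forall i j m v, K v -> K (opL r F i j m v).

Lemma K_opH j v : K v -> K (opH F j v).
Proof. by move=> kv; rewrite -(opL_opH r j (K_good kv)); apply: K_opL. Qed.

(* For i <> j the summands v^{ij}(m-h,h) of L^{ij}(m) shift the weight of
   L^{jj}(0) by different amounts, so that each of them preserves K. *)
Lemma K_opA_weight i j m n (z : C) u : i != j -> K u ->
  opH F j u = z *: u -> K (opA r (i, j, m, n) u).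
Proof.
move=> ij ku Hu.
have [N0 h] := opL_sumA r i j (m + n) (K_good ku).
pose N := maxn N0 `|n|%N.
have := K_opL i j (m + n) ku; rewrite (h N) ?leq_maxl // /sumA (negPf ij) /=.
move=> /K_unscale; rewrite invr_eq0 => /(_ (natC_neq0 1)) Ks.
(* In L^{ij}(m + n), the summand v^{ij}(m,n) is the one with h = n, at position n + N of the
   window. *)
have kt : `|(n + N%:Z)%R|%N \in index_iota 0 (N + N).+1.
  rewrite mem_index_iota /N; lia.
have := @eigen_split (opH F j) _ _ (fun t : nat => z - (t%:Z - N%:Z)%:~R)
  _ _ (iota_uniq _ _) _ _ Ks _ kt.
have -> : `|(n + N%:Z)%R|%N%:Z = n + N%:Z by rewrite /N; lia.
rewrite addrK addrK; apply.
- exact: K_opH.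
- move=> x y _ _ /addrI /oppr_inj /intC_inj; lia.
- by move=> t; apply: opH_opA.
Qed.

Lemma K_opA i j m n v : i != j -> K v -> K (opA r (i, j, m, n) v).
Proof.
move=> ij kv; have [M [u [Hu vE]]] := weight_decomposition j v.
have Ku : {in iota 0 M, forall N, K (u N)}.
  apply: (eigen_split (H := opH F j) (lam := fun N => N%:R)).
  - exact: K_opH.
  - exact: iota_uniq.
  - by move=> x y _ _ /(@intC_inj x y) [].
  - exact: Hu.
  - by rewrite -vE.
rewrite vE linear_sum; apply: K_sum => N sN.
by apply: (K_opA_weight _ _ ij (Ku N sN) (Hu N)).
Qed.

Lemma K_X_neq a b v : a.1 != b.1 -> K v -> K (mB (xk a b) v).
Proof. by case: a b => [i p] [j q]; apply: (@K_opA i j (Negz p) (Negz q)). Qed.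

Lemma K_opE_neq a b v : a.1 != b.1 -> K v -> K (opE a b v).
Proof.
case: a b => [i p] [j q] ij kv; apply: (K_unscale (natC_neq0 p)).
exact: (@K_opA i j (Posz p.+1) (Negz q)).
Qed.

Lemma K_opD_neq a b v : a.1 != b.1 -> K v -> K (opD a b v).
Proof.
case: a b => [i p] [j q] ij kv.
apply: (@K_unscale (p.+1%:R * q.+1%:R)); first by rewrite mulf_neq0 // natC_neq0.
exact: (@K_opA i j (Posz p.+1) (Posz q.+1)).
Qed.

Hypothesis d_ge2 : (2 <= d)%N.

Lemma other_index (i : 'I_d) : exists j : 'I_d, j != i.
Proof.
have d0 : (0 < d)%N by apply: ltn_trans d_ge2.
case: (eqVneq (i : nat) 0%N) => [i0|i0].
  by exists (Ordinal d_ge2); rewrite -val_eqE /= i0.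
by exists (Ordinal d0); rewrite -val_eqE /= eq_sym.
Qed.

(** If a and b share their index, x_ab is the commutator of the replacement of c by a with x_cb,
    where c has another index; this is where d >= 2 enters. *)
Lemma K_X a b v : K v -> K (mB (xk a b) v).
Proof.
move=> kv; case: (eqVneq a.1 b.1) => [ab|]; last by move/K_X_neq; apply.
have [j ji] := other_index b.1; pose c : L := (j, 0%N).
have ca : c.1 != a.1 by rewrite ab.
have -> : mB (xk a b) v = opE c a (mB (xk c b) v) - mB (xk c b) (opE c a v).
  have cb : c != b by apply/eqP => e; rewrite /c -e eqxx in ji.
  by rewrite opE_X dlxx (dl_neq cb); vring.
by apply: K_sub; [apply: K_opE_neq => //; apply: K_X_neq|
  apply: K_X_neq => //; apply: K_opE_neq].
Qed.

Lemma K_opD a b v : K v -> K (opD a b v).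
Proof.
move=> kv; case: (eqVneq a.1 b.1) => [ab|]; last by move/K_opD_neq; apply.
have [j ji] := other_index b.1; pose c : L := (j, 0%N).
have ac : a.1 != c.1 by rewrite ab eq_sym.
have -> : opD a b v = opD c b (opE a c v) - opE a c (opD c b v).
  have bc : b != c by apply/eqP => e; rewrite /c e eqxx in ji.
  by rewrite opD_opE dlxx (dl_neq bc); vring.
by apply: K_sub; [apply: K_opD_neq => //; apply: K_opE_neq|
  apply: K_opE_neq => //; apply: K_opD_neq].
Qed.

Lemma K_contains_good : K vc -> forall v, good v -> K v.
Proof.
move=> k1; apply: good_ind => // k v gk _ kv.
by rewrite -(xk_lab gk); apply: K_X.
Qed.

(** A filtration by the number of generators, not by conformal degree: each [opD] lowers it by one,
    so the descent in [K_vac] terminates. *)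
Definition lowdeg (N : nat) v : Prop := exists s : seq (C * seq key),
  all (fun x => size x.2 < N)%N s /\ v = \sum_(x <- s) x.1 *: mv x.2.

Lemma lowdeg0 N : lowdeg N 0. Proof. by exists [::]; rewrite big_nil. Qed.

Lemma lowdeg_lin N x u v : lowdeg N u -> lowdeg N v -> lowdeg N (x *: u + v).
Proof.
move=> [s [hs ->]] [t [ht ->]].
exists ([seq (x * y.1, y.2) | y <- s] ++ t); split.
  by rewrite all_cat all_map ht andbT.
rewrite big_cat big_map scaler_sumr; congr (_ + _).
by apply: eq_bigr => y _; rewrite scalerA.
Qed.

Lemma lowdegD N u v : lowdeg N u -> lowdeg N v -> lowdeg N (u + v).
Proof. by rewrite -{2}[u]scale1r; apply: lowdeg_lin. Qed.
Lemma lowdegZ N x v : lowdeg N v -> lowdeg N (x *: v).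
Proof. by move=> kv; rewrite -[_ *: _]addr0; apply: lowdeg_lin (lowdeg0 N). Qed.

Lemma lowdeg_mv N w : (size w < N)%N -> lowdeg N (mv w).
Proof. by exists [:: (1, w)]; rewrite /= H big_seq1 scale1r. Qed.

Lemma lowdeg_mB N k v : lowdeg N v -> lowdeg N.+1 (mB k v).
Proof.
move=> [s [hs ->]]; exists [seq (y.1, k :: y.2) | y <- s]; rewrite all_map.
split=> //; rewrite linear_sum big_map; apply: eq_bigr => y _ /=.
by rewrite mBZ mul_mv.
Qed.

Lemma lowdeg_opE a b w : lowdeg (size w).+1 (opE a b (mv w)).
Proof.
elim: w => [|k w IH]; first by rewrite opE_vac; apply: lowdeg0.
by rewrite -mul_mv opE_mB; apply: lowdegD; first apply: lowdegD;
  rewrite /=; try apply: lowdegZ; apply: lowdeg_mB; rewrite ?IH //;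
  apply: lowdeg_mv.
Qed.

Lemma lowdeg_opD_mv a b w : lowdeg (size w) (opD a b (mv w)).
Proof.
elim: w => [|k w IH]; first by rewrite opD_vac; apply: lowdeg0.
rewrite -mul_mv opD_mB /=; apply: lowdegD; last by apply: lowdegZ; apply: lowdeg_mv.
do 4!(apply: lowdegD; last by apply: lowdegZ; apply: lowdeg_opE).
exact: lowdeg_mB.
Qed.

Lemma lowdeg_opD a b N v : lowdeg N.+1 v -> lowdeg N (opD a b v).
Proof.
move=> [s [hs ->]]; rewrite linear_sum /=.
elim: s hs => [|[x w] s IH] /=; first by rewrite big_nil => _; apply: lowdeg0.
case/andP => hw hs; rewrite big_cons opDZ; apply: lowdeg_lin; last exact: IH.
have [t [ht ->]] := lowdeg_opD_mv a b w; exists t; split=> //.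
by apply: sub_all ht => y /= h; apply: leq_trans h _.
Qed.

Lemma lowdeg_exists v : exists N, lowdeg N v.
Proof.
elim/Fock_mono_ind: v => [|x u v [N1 h1] [N2 h2]|w].
- by exists 0%N; apply: lowdeg0.
- exists (maxn N1 N2); apply: lowdeg_lin; [case: h1|case: h2] => s [hs ->];
    exists s; split=> //; apply: sub_all hs => y h; apply: leq_trans h _.
    exact: leq_maxl.
  exact: leq_maxr.
- by exists (size w).+1; apply: lowdeg_mv.
Qed.

Lemma K_vac v : (forall z : int, r <> z%:~R) -> K v -> v != 0 -> K vc.
Proof.
move=> rZ; have [N] := lowdeg_exists v.
elim: N v => [|N IH] v hv kv v0.
  case: hv v0 => [[|x s]] [//] _ ->; by rewrite big_nil eqxx.
have [[a [b Dv]]|noD] := classic (exists a b, opD a b v != 0).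
  exact: (IH _ (lowdeg_opD a b hv) (K_opD a b kv) Dv).
have Dv a b : opD a b v = 0.
  by apply/eqP; apply/negPn/negP => h; apply: noD; exists a, b.
have vE := harmonic_const rZ (K_good kv) Dv.
apply: (@K_unscale (coef mset0 v)); last by rewrite -vE.
by apply/eqP => c0; rewrite vE c0 scale0r eqxx in v0.
Qed.

End Closure.

(** * Ideals of the vertex operator algebra *)

Section Ideals.
Variables (d : nat) (V : lmodType C) (inV : V -> Prop) (one : V).
Variables (Lo : 'I_d -> 'I_d -> int -> V -> V) (om : 'I_d -> 'I_d -> V).
Variables (Lm1 : V -> V) (Y : V -> int -> V -> V).
Hypothesis Y_in : forall u w n, inV u -> inV w -> inV (Y u n w).
Hypothesis Y_linl : forall (a : C) u u' w n, inV u -> inV u' -> inV w ->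
  Y (a *: u + u') n w = a *: Y u n w + Y u' n w.
Hypothesis Y_linr : forall (a : C) u w w' n, inV u -> inV w -> inV w' ->
  Y u n (a *: w + w') = a *: Y u n w + Y u n w'.
Hypothesis Y_trunc : forall u w, inV u -> inV w ->
  exists N : int, forall n, N <= n -> Y u n w = 0.
Hypothesis Y_one : forall w n, inV w -> Y one n w = if n == -1 then w else 0.
Hypothesis Y_creation : forall u, inV u ->
  Y u (-1) one = u /\ forall n, 0 <= n -> Y u n one = 0.
Hypothesis Y_borcherds : forall u v w (p q n : int) (K : nat),
  inV u -> inV v -> inV w ->
  (forall i : nat, (K <= i)%N ->
     [/\ Y u (n + i%:Z) v = 0, Y v (q + i%:Z) w = 0 & Y u (p + i%:Z) w = 0]) ->
  \sum_(i < K) binz p i *: Y (Y u (n + i%:Z) v) (p + q - i%:Z) w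
  = \sum_(i < K) ((-1) ^+ i * binz n i) *:
      (Y u (p + n - i%:Z) (Y v (q + i%:Z) w)
       - ((-1 : C) ^ n) *: Y v (q + n - i%:Z) (Y u (p + i%:Z) w)).
Hypothesis Y_derivative : forall v w n, inV v -> inV w ->
  Y (Lm1 v) n w = - (n%:~R) *: Y v (n - 1) w.
Hypothesis Y_om : forall i j w n, inV w -> Y (om i j) n w = Lo i j (n - 1) w.
Hypothesis om_in : forall i j, inV (om i j).
Hypothesis one_in : inV one.

Hypothesis inV_ind : forall P : V -> Prop,
  (P 0) -> (forall (a : C) u v, inV u -> P u -> inV v -> P v -> P (a *: u + v)) ->
  P one -> (forall i j m u, inV u -> P u -> P (Lo i j m u)) ->
  forall u, inV u -> P u.

Variable K : V -> Prop.
Hypothesis K0 : K 0.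
Hypothesis K_lin : forall (x : C) u v, K u -> K v -> K (x *: u + v).
Hypothesis K_in : forall v, K v -> inV v.
Hypothesis K_Lo : forall i j m v, K v -> K (Lo i j m v).
Hypothesis K_Lm1 : forall v, K v -> K (Lm1 v).

Let zero_in : inV 0 := K_in K0.

Lemma Y_0l n w : inV w -> Y 0 n w = 0.
Proof.
move=> iw; have := Y_linl (-1) n zero_in zero_in iw.
by rewrite scaler0 addr0 scaleN1r addNr.
Qed.

Lemma Y_0r n u : inV u -> Y u n 0 = 0.
Proof.
move=> iu; have := Y_linr (-1) n iu zero_in zero_in.
by rewrite scaler0 addr0 scaleN1r addNr.
Qed.

(** The bound is a successor so that the summand i = 0 can be split off. *)
Lemma common_truncation u v w (p q n : int) : inV u -> inV v -> inV w ->
  exists k : nat, forall i : nat, (k.+1 <= i)%N ->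
   [/\ Y u (n + i%:Z) v = 0, Y v (q + i%:Z) w = 0 & Y u (p + i%:Z) w = 0].
Proof.
move=> iu iv iw; have [N1 h1] := Y_trunc iu iv; have [N2 h2] := Y_trunc iv iw.
have [N3 h3] := Y_trunc iu iw.
exists (`|(N1 - n)%R| + `|(N2 - q)%R| + `|(N3 - p)%R|)%N => i le.
by split; [apply: h1|apply: h2|apply: h3]; lia.
Qed.

Lemma binz0 k : binz 0 k = (k == 0%N)%:R.
Proof.
case: k => [|k]; rewrite /binz ?big_ord0 ?divr1 //.
by rewrite big_ord_recl /= subrr mul0r mul0r.
Qed.

Lemma Ksum (I : finType) (f : I -> C) (u : I -> V) :
  (forall i, K (u i)) -> K (\sum_i f i *: u i).
Proof.
move=> h; elim/big_ind: _ => [//|u1 u2 k1 k2|i _].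
  by rewrite -[u1]scale1r; apply: K_lin.
by rewrite -[_ *: _]addr0; apply: K_lin.
Qed.

Lemma Ksub u v : K u -> K v -> K (u - v).
Proof. by move=> ku kv; rewrite addrC -scaleN1r; apply: K_lin. Qed.

Lemma K_om i j n w : K w -> K (Y (om i j) n w).
Proof. by move=> kw; have iw := K_in kw; rewrite Y_om //; apply: K_Lo. Qed.

Lemma Lo_Y i j m u : inV u -> Lo i j m u = Y (om i j) (m + 1) u.
Proof. by move=> iu; rewrite Y_om // addrK. Qed.

Lemma ideal_left u n w : inV u -> K w -> K (Y u n w).
Proof.
move=> iu; move: u iu n w; apply: inV_ind => [|a u v iu Pu iv Pv||i j m u iu Pu] n w kw;
  have iw := K_in kw.
- by rewrite Y_0l.
- by rewrite Y_linl //; apply: K_lin; [apply: Pu|apply: Pv].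
- by rewrite Y_one //; case: ifP.
rewrite Lo_Y //.
(* Associativity, the Borcherds identity with p = 0: the left side is the mode n of L^{ij}(m) u, the
   right side combines modes of [om i j] and of u applied in turn to w. *)
have [k hk] := common_truncation 0 n (m + 1) (om_in i j) iu (K_in kw).
have := Y_borcherds (om_in i j) iu (K_in kw) hk.
rewrite big_ord_recl big1 ?addr0 => [|l _].
  rewrite binz0 eqxx scale1r ?subr0 add0r ?addr0 => ->; apply: Ksum => l.
  apply: Ksub; first by apply: K_om; apply: Pu.
  rewrite -[_ *: _]addr0; apply: K_lin => //; apply: Pu.
  exact: K_om.
by rewrite binz0 /= scale0r.
Qed.

Lemma ideal_right u n w : inV u -> K w -> K (Y w n u).
Proof.
move=> iu; move: u iu n w; apply: inV_ind => [|a u v iu Pu iv Pv||i j m u iu Pu] n w kw;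
  have iw := K_in kw.
- by rewrite Y_0r.
- by rewrite Y_linr //; apply: K_lin; [apply: Pu|apply: Pv].
(* On the vacuum w_n vanishes for n >= 0, and w_(-k-1) yields L(-1)^k w / k! by the derivative
   property. *)
- have [wE w0] := Y_creation (K_in kw).
  case: n => [n|n]; first by rewrite w0.
  elim: n w kw {iw wE w0} => [|n IH] w kw.
    by have [-> _] := Y_creation (K_in kw).
  have := Y_derivative (Negz n) (K_in kw) one_in.
  have -> : Negz n - 1 = Negz n.+1 by lia.
  rewrite NegzE intrN opprK => e.
  have -> : Y w (- n.+2%:Z) one = (n.+1%:R)^-1 *: Y (Lm1 w) (Negz n) one.
    by rewrite NegzE e scalerA mulVf ?scale1r // natC_neq0.
  by rewrite -[_ *: _]addr0; apply: K_lin => //; apply: IH; apply: K_Lm1.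
rewrite Lo_Y //.
(* The commutator formula, the Borcherds identity with third exponent 0: the commutator is a sum of
   modes of the vectors om_l w, which lie in K, applied to u. *)
have [k hk] := common_truncation (m + 1) n 0 (om_in i j) (K_in kw) iu.
have := Y_borcherds (om_in i j) (K_in kw) iu hk.
rewrite [X in _ = X -> _]big_ord_recl [X in _ = _ + X -> _]big1 ?addr0 => [|l _].
  rewrite binz0 eqxx expr0 mulr1 expr0z !scale1r ?subr0 ?addr0 => e.
  have -> : Y w n (Y (om i j) (m + 1) u) =
      Y (om i j) (m + 1) (Y w n u) -
      (Y (om i j) (m + 1) (Y w n u) - Y w n (Y (om i j) (m + 1) u)).
    by rewrite subKr.
  apply: Ksub; first by apply: K_om; apply: Pu.
  by rewrite -e; apply: Ksum => l; apply: Pu; apply: K_om.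
by rewrite binz0 /= mulr0 scale0r.
Qed.

End Ideals.

Lemma sum_lin (V : lmodType C) (T : Type) (f : T -> V) (x : C) (s t : seq (C * T)) :
  x *: (\sum_(y <- s) y.1 *: f y.2) + \sum_(y <- t) y.1 *: f y.2 =
  \sum_(y <- [seq (x * y.1, y.2) | y <- s] ++ t) y.1 *: f y.2.
Proof.
rewrite big_cat big_map scaler_sumr; congr (_ + _).
by apply: eq_bigr => y _; rewrite scalerA.
Qed.

(** * The concrete space and the simplicity criterion *)

Section Concrete.
Variables (d : nat) (r : C).
Local Notation F := (VecFock d).

Lemma LopE i j m (v : Vec d) : Lop r i j m v = opL r F i j m v.
Proof. by []. Qed.

Lemma inVJ0 : inVJ r (0 : Vec d).
Proof. by exists [::]; rewrite big_nil. Qed.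

Lemma inVJ_lin (x : C) (u v : Vec d) :
  inVJ r u -> inVJ r v -> inVJ r (x *: u + v).
Proof.
move=> [s ->] [t ->]; exists ([seq (x * y.1, y.2) | y <- s] ++ t).
exact: (@sum_lin (Vec d : lmodType C)).
Qed.

Lemma inVJ_Lmon s : inVJ r (Lmon r s : Vec d).
Proof. by exists [:: (1, s)]; rewrite big_seq1 scale1r. Qed.

Lemma inVJ_Lop i j m (v : Vec d) : inVJ r v -> inVJ r (Lop r i j m v).
Proof.
move=> [s ->]; exists [seq (y.1, (i, j, m) :: y.2) | y <- s].
rewrite big_map LopE linear_sum; apply: eq_bigr => y _ /=.
by rewrite linearZZ -LopE.
Qed.

Lemma good_Lmon s : good (Lmon r s : F).
Proof.
elim: s => [|[[i j] m] s IH]; first exact: (@good_mv d F [::]).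
by rewrite /= LopE; apply: good_opL.
Qed.

Lemma inVJ_good (v : Vec d) : (2 <= d)%N -> inVJ r v <-> good (v : F).
Proof.
move=> d2; split=> [[s ->]|].
  elim: s => [|y s IH]; first by rewrite big_nil; apply: good0.
  by rewrite big_cons; apply: good_lin => //; apply: good_Lmon.
apply: (@K_contains_good d r F (inVJ r) inVJ0 inVJ_lin) => //.
- move=> {}v [s ->]; elim: s => [|y s IH]; first by rewrite big_nil; apply: good0.
  by rewrite big_cons; apply: good_lin => //; apply: good_Lmon.
- by move=> i j m u; rewrite -LopE; apply: inVJ_Lop.
- exact: (inVJ_Lmon [::]).
Qed.

Lemma inVJ_ind (P : Vec d -> Prop) :
  P 0 -> (forall (a : C) u v, inVJ r u -> P u -> inVJ r v -> P v -> P (a *: u + v)) ->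
  P (vac d) -> (forall i j m u, inVJ r u -> P u -> P (Lop r i j m u)) ->
  forall u, inVJ r u -> P u.
Proof.
move=> P0 PD P1 PL u [s ->].
suff [] : inVJ r (\sum_(x <- s) x.1 *: Lmon r x.2) /\
  P (\sum_(x <- s) x.1 *: Lmon r x.2) by [].
elim: s => [|[x t] s [IH1 IH2]]; first by rewrite big_nil; split=> //; apply: inVJ0.
rewrite big_cons; have It := inVJ_Lmon t; split; first exact: inVJ_lin.
apply: PD => //=; elim: t {It} => [|[[i j] m] t IHt] //.
by apply: PL => //; apply: inVJ_Lmon.
Qed.

(* The level is an integer: the radical contains a determinant of size r + 1
   when r >= 0, and a power of x_aa or of x_aa x_bb - x_ab^2 otherwise. *)
Lemma integral_level_null_vector : (2 <= d)%N -> (exists z : int, r = z%:~R) ->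
  exists v : F, [/\ good v, null r v & v != 0].
Proof.
move=> d2 [z rz]; have d0 : (0 < d)%N by apply: ltn_trans d2.
pose i0 := Ordinal d0; pose lab n : Lab d := (i0, n).
have labE m n : (lab m == lab n) = (m == n) by rewrite xpair_eqE eqxx.
case: z rz => [n|n] rz.
  (* All labels share the index [i0]; the column modes are shifted beyond the row modes. *)
  pose c (p : 'I_n.+1) := lab p; pose e (p : 'I_n.+1) := lab (n.+1 + p)%N.
  have c_inj : injective c by move=> p q /eqP; rewrite labE => /eqP /val_inj.
  have e_inj : injective e.
    by move=> p q /eqP; rewrite labE eqn_add2l => /eqP /val_inj.
  have ce p q : c p != e q by rewrite labE neq_ltn ltn_addr.
  exists (minor F c e); split; first exact: good_minor.
    by apply: minor_null => //.
  exact: minor_neq0.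
have ab : lab 0 != lab 1 by rewrite labE.
move: rz; rewrite NegzE intrN -[(Posz n.+1)%:~R]/(n.+1%:R) => rz.
(* Here r = -(n + 1), which is -2(n./2 + 1) for odd n and 1 - 2(n./2 + 1) for even n. *)
have [nodd|neven] := boolP (odd n).
  exists (pw F (lab 0) n./2.+2); split; [exact: good_pw| |exact: pw_neq0].
  apply: pw_null; rewrite rz; congr (- _%:R).
  by rewrite -[in LHS](odd_double_half n) nodd; lia.
exists (dt F (lab 0) (lab 1) n./2.+2); split; [exact: good_dt| |exact: dt_neq0].
apply: dt_null; rewrite rz.
have -> : (2 * n./2.+1)%N = (n.+1 + 1)%N.
  by rewrite -[in RHS](odd_double_half n) (negPf neven); lia.
by rewrite natrD; ring.
Qed.

End Concrete.

Theorem theorem2p6 (d : nat) (r : C) :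
  (2 <= d)%N ->
  forall Y : Vec d -> int -> Vec d -> Vec d,
    IsVOA r Y ->
    (IsSimple r Y <-> ~ (exists z : int, r = z%:~R)).
Proof.
move=> d2 Y [Yin [Yll [Ylr [Ytr [Yone [Ycr [Ybo [Yder Yom]]]]]]]].
have om_in (i j : 'I_d) : inVJ r (omega_ij r i j) by apply: inVJ_Lop (inVJ_Lmon r [::]).
have vac_in : inVJ r (vac d) by apply: (inVJ_Lmon r [::]).
split=> [simple rZ|rZ I [I_in [I0 [I_lin I_Y]]]].
  pose I v := inVJ r v /\ null r (v : VecFock d).
  have I_lin (x : C) u v : I u -> I v -> I (x *: u + v).
    by move=> [u1 u2] [v1 v2]; split; [apply: inVJ_lin|apply: null_lin].
  have I0 : I 0 by split; [apply: inVJ0|apply: null0].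
  have I_Lo i j m v : I v -> I (Lop r i j m v).
    move=> [v1 v2]; split; first exact: inVJ_Lop.
    by rewrite LopE; apply: null_opL => //; apply/(inVJ_good r).
  have I_Lm1 v : I v -> I (Lvir r (-1) v).
    move=> Iv; rewrite /Lvir; elim/big_ind: _ => [//|u1 u2 h1 h2|i _].
      by rewrite -[u1]scale1r; apply: I_lin.
    exact: I_Lo.
  have I_in v : I v -> inVJ r v by case.
  have idI : IsIdeal r Y I.
    split=> //; split=> //; split=> // u w n iu Iw; split.
      exact: (ideal_left Yll Ytr Yone Ybo Yom om_in (@inVJ_ind d r)
        I0 I_lin I_in I_Lo).
    exact: (ideal_right Ylr Ytr Ycr Ybo Yder Yom om_in vac_in
      (@inVJ_ind d r) I0 I_lin I_in I_Lo I_Lm1).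
  have [v [gv nv v0]] := integral_level_null_vector d2 rZ.
  case: (simple I idI) => [I_0|I_all].
    have /I_0 e : I v by split=> //; apply/(inVJ_good r).
    by rewrite e eqxx in v0.
  have [_] : I (vac d) by apply/I_all.
  exact: (@vac_not_null d r (VecFock d)).
have I_good v : I v -> good (v : VecFock d) by move=> /I_in /(inVJ_good r v d2).
have I_Lo i j m v : I v -> I (opL r (VecFock d) i j m v).
  (* L^{ij}(m) is the mode m + 1 of omega^{ij}, so the ideal is closed under it. *)
  move=> Iv; rewrite -LopE -[m](addrK 1) -Yom; last exact: I_in.
  by have [] := I_Y _ _ (m + 1) (om_in i j) Iv.
have [[v [Iv v0]]|I_0] := classic (exists v, I v /\ v != 0); last first.
  left=> v; split=> [Iv|-> //]; apply/eqP/negPn/negP => v0.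
  by apply: I_0; exists v.
right=> w; split=> [/I_in //|/(inVJ_good r w d2)].
have rZ' z : r <> z%:~R by move=> e; apply: rZ; exists z.
apply: (@K_contains_good d r (VecFock d) I I0 I_lin I_good I_Lo d2).
exact: (@K_vac d r (VecFock d) I I0 I_lin I_good I_Lo d2 v rZ' Iv v0).
Qed.
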